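(* If $R$ is a unital associative ring which is isomorphic (as a ring) with its opposite ring $R^{op}$, then $\mathrm{silp}\, R \leq \mathrm{spli}\, R$, with equality if $\mathrm{spli}\, R < \infty$.
   Context: $\mathrm{spli}\, R$ is the supremum of the projective dimensions of injective left $R$-modules and $\mathrm{silp}\, R$ is the supremum of the injective dimensions of projective left $R$-modules (suprema in $\mathbb{N}\cup\{\infty\}$). *)

(* Defs.v *)
From HB Require Import structures.
From mathcomp Require Import all_boot all_order all_algebra.
From mathcomp Require Import boolp.

Set Implicit Arguments.
Unset Strict Implicit.
Unset Printing Implicit Defensive.

Import Order.TTheory GRing.Theory.

(* The ordered set N u {oo}: [Some n] is the natural number n, and [None],
   the top element [\top], is infinity. *)
Definition enat : Type := option nat.

HB.instance Definition _ := Countable.on enat.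

Fact enat_display : Order.disp_t. Proof. exact: Order.Disp tt tt. Qed.

Definition enat_le (x y : enat) : bool :=
  match x, y with
  | _, None => true
  | None, Some _ => false
  | Some m, Some n => (m <= n)%N
  end.

Fact enat_le_refl : reflexive enat_le.
Proof. by case=> //= n. Qed.

Fact enat_le_anti : antisymmetric enat_le.
Proof. by case=> [m|] [n|] //=; rewrite -eqn_leq => /eqP ->. Qed.

Fact enat_le_trans : transitive enat_le.
Proof. by case=> [m|] [n|] [p|] //=; apply: leq_trans. Qed.

Fact enat_le_total : total enat_le.
Proof. by case=> [m|] [n|] //=; apply: leq_total. Qed.

HB.instance Definition _ := Order.Le_isPOrder.Build enat_display enat
  enat_le_refl enat_le_anti enat_le_trans.
HB.instance Definition _ :=
  Order.POrder_isTotal.Build enat_display enat enat_le_total.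

Fact enat_lex1 (x : enat) : (x <= (None : enat))%O.
Proof. by case: x. Qed.

HB.instance Definition _ :=
  Order.hasTop.Build enat_display enat enat_lex1.

Definition enat_inf (P : nat -> Prop) : enat :=
  match pselect (exists n, `[< P n >]) with
  | left exP => Some (ex_minn exP)
  | right _ => \top%O
  end.

(* The least upper bound of S: it is infinite exactly when no natural number
   bounds S from above. *)
Definition enat_sup (S : enat -> Prop) : enat :=
  enat_inf (fun n => forall x, S x -> (x <= (Some n : enat))%O).

Local Open Scope ring_scope.

(* All modules are left modules. They range over [lmodType R], whose carriers
   live in one fixed universe containing that of R. *)
Section HomologicalDimensions.
Variable R : pzRingType.

Definition module_projective (P : lmodType R) : Prop :=
  forall (A B : lmodType R) (g : {linear A -> B}) (f : {linear P -> B}),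
    (forall b, exists a, g a = b) ->
    exists h : {linear P -> A}, forall x, g (h x) = f x.

Definition module_injective (I : lmodType R) : Prop :=
  forall (A B : lmodType R) (g : {linear A -> B}) (f : {linear A -> I}),
    injective g ->
    exists h : {linear B -> I}, forall x, h (g x) = f x.

Definition exact_at (A B C : lmodType R) (f : {linear A -> B})
    (g : {linear B -> C}) : Prop :=
  forall b, g b = 0 <-> exists a, f a = b.

(* ... -> P 2 -> P 1 -> P 0 -> M -> 0 *)
Definition projective_resolution (M : lmodType R) (P : nat -> lmodType R)
    (d : forall i, {linear P i.+1 -> P i}) (e : {linear P 0%N -> M}) : Prop :=
  [/\ forall i, module_projective (P i),
      forall m, exists x, e x = m,
      exact_at (d 0%N) e
    & forall i, exact_at (d i.+1) (d i)].

(* 0 -> M -> I 0 -> I 1 -> I 2 -> ... *)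
Definition injective_resolution (M : lmodType R) (I : nat -> lmodType R)
    (e : {linear M -> I 0%N}) (d : forall i, {linear I i -> I i.+1}) : Prop :=
  [/\ forall i, module_injective (I i),
      injective e,
      exact_at e (d 0%N)
    & forall i, exact_at (d i) (d i.+1)].

Definition zero_above (X : nat -> lmodType R) (n : nat) : Prop :=
  forall i, (n < i)%N -> forall x : X i, x = 0.

(* The projective (resp. injective) dimension is the least length of a
   projective (resp. injective) resolution; the zero module has dimension 0. *)
Definition proj_dim (M : lmodType R) : enat :=
  enat_inf (fun n => exists (P : nat -> lmodType R)
    (d : forall i, {linear P i.+1 -> P i}) (e : {linear P 0%N -> M}),
    projective_resolution d e /\ zero_above P n).

Definition inj_dim (M : lmodType R) : enat :=
  enat_inf (fun n => exists (I : nat -> lmodType R)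
    (e : {linear M -> I 0%N}) (d : forall i, {linear I i -> I i.+1}),
    injective_resolution e d /\ zero_above I n).

Definition spli : enat :=
  enat_sup (fun x => exists2 I : lmodType R, module_injective I & x = proj_dim I).

Definition silp : enat :=
  enat_sup (fun x => exists2 P : lmodType R, module_projective P & x = inj_dim P).

End HomologicalDimensions.

(* Main.v *)
Require Import Defs.
From HB Require Import structures.
From mathcomp Require Import all_boot all_order all_algebra.
From mathcomp Require Import boolp classical_sets functions.

(** An anti-automorphism of R makes the character module of a left R-module a
    left R-module again, so that spli R = n controls both sides.  Every module M
    of finite injective dimension has pd M <= n, and pd M <= n implies that the
    character module of M has injective dimension at most n.  Hence a projective
    module P has an exact coresolution X built from the pure embeddings of the
    successive cokernels C into their double duals, and all the double duals
    have injective dimension at most n.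

    On the other side every n-th syzygy embeds into a projective module with
    cokernel an n-th syzygy, which yields an acyclic complex T of projective
    modules continuing a projective resolution to the right.  As
    Ext^1(n-th syzygy, double dual) = 0, a map from a syzygy to P extends to a
    chain map from T to X.  A chain map from a complex of projectives to a pure
    exact complex is null-homotopic (Neeman, Emmanouil): a complex of free
    modules is exhausted by subcomplexes whose successive quotients have
    finitely many generators in each degree, and there the homotopy is built by
    solving finite linear systems.  The homotopy gives Ext^{n+1}(M, P) = 0 for
    all M, that is, id P <= n.  Once silp R and spli R are both finite they agree
    by dimension shifting. *)

Set Implicit Arguments.
Unset Strict Implicit.
Unset Printing Implicit Defensive.

Import Order.TTheory GRing.Theory Num.Theory.

Local Open Scope ring_scope.

(** * Submodules and quotient modules *)

Section ModuleConstructions.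
Variable R : pzRingType.

(* Opaque, so that simplification does not unfold the linear maps built below. *)
Fact Lin_subproof (A B : lmodType R) (f : A -> B) (fL : linear f) :
  {g : {linear A -> B} | g =1 f}.
Proof.
pose g : {linear A -> B} := HB.pack f (GRing.isLinear.Build R A B *:%R f fL).
by exists g.
Qed.

Definition Lin (A B : lmodType R) (f : A -> B) (fL : linear f) :
  {linear A -> B} := sval (Lin_subproof fL).

Lemma LinE (A B : lmodType R) (f : A -> B) (fL : linear f) : Lin fL =1 f.
Proof. exact: svalP (Lin_subproof fL). Qed.

Lemma factor_surj (Y B D : lmodType R) (q : {linear Y -> B})
    (g : {linear Y -> D}) :
    (forall b, exists y, q y = b) -> (forall y, q y = 0 -> g y = 0) ->
  exists h : {linear B -> D}, forall y, h (q y) = g y.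
Proof.
move=> /choice[s qs] qg.
have gE y y' : q y = q y' -> g y = g y'.
  by move=> e; apply/subr0_eq; rewrite -linearB qg // linearB e subrr.
have hL : linear (fun b => g (s b)).
  by move=> a x y; rewrite -linearP; apply: gE; rewrite linearP !qs.
by exists (Lin hL) => y; rewrite LinE; apply: gE; rewrite qs.
Qed.

Lemma factor_inj (A B X : lmodType R) (i : {linear A -> B})
    (u : {linear X -> B}) :
    injective i -> (forall x, exists a, i a = u x) ->
  exists h : {linear X -> A}, forall x, i (h x) = u x.
Proof.
move=> injI /choice[h iu].
have hL : linear h by move=> a x y; apply: injI; rewrite linearP !iu linearP.
by exists (Lin hL) => x; rewrite LinE.
Qed.

(** Predicate and closure proof are bundled so that [subm] and [quotm] depend on the single argument
    [W], on which the module structures are declared. *)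
Record submodule (V : lmodType R) := Submodule {
  mem_submodule : {pred V};
  submodule_closed : submod_closed mem_submodule }.

Section Submodule.
Variables (V : lmodType R) (W : submodule V).

Definition subm_pred : {pred V} := mem_submodule W.

HB.instance Definition _ :=
  GRing.isSubmodClosed.Build R V subm_pred (submodule_closed W).

Record subm : Type := Subm { subm_val : V; _ : subm_val \in subm_pred }.

HB.instance Definition _ := [isSub for subm_val].
HB.instance Definition _ := [Choice of subm by <:].
HB.instance Definition _ := [SubChoice_isSubLmodule of subm by <:].

Lemma subm_val_linear : linear subm_val.
Proof. by []. Qed.

Definition subm_incl : {linear subm -> V} := Lin subm_val_linear.

Lemma subm_inclE x : subm_incl x = subm_val x.
Proof. exact: LinE. Qed.

Lemma subm_incl_inj : injective subm_incl.
Proof. by move=> x y; rewrite !subm_inclE; exact: val_inj. Qed.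

Lemma subm_inclP v : v \in mem_submodule W <-> exists x, subm_incl x = v.
Proof.
split=> [Wv|[[x Wx] <-]]; last by rewrite subm_inclE.
by exists (Subm Wv); rewrite subm_inclE.
Qed.

HB.instance Definition _ := GRing.isZmodClosed.Build V subm_pred
  (GRing.submod_closedB (submodule_closed W)).

Definition quotm : Type := Quotient.quot subm_pred.
HB.instance Definition _ := GRing.Zmodule.on quotm.

Definition quotm_pi (v : V) : quotm := (\pi_(Quotient.quot subm_pred) v)%qT.

Lemma quotm_pi_eq x y : quotm_pi x = quotm_pi y <-> x - y \in mem_submodule W.
Proof.
rewrite /quotm_pi; split.
  by move=> e; have := Quotient.idealrBE subm_pred x y; rewrite e eqxx.
by move=> h; apply/eqP; rewrite -Quotient.idealrBE.
Qed.

Lemma quotm_pi_surj (b : quotm) : exists v, quotm_pi v = b.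
Proof. by exists (repr b); rewrite /quotm_pi reprK. Qed.

Definition quotm_scale (a : R) (b : quotm) : quotm := quotm_pi (a *: repr b).

(** Closure under scaling makes the representative chosen in [quotm_scale] irrelevant; the module
    axioms then descend along the surjection [quotm_pi]. *)
Lemma quotm_piZ a v : quotm_pi (a *: v) = quotm_scale a (quotm_pi v).
Proof.
rewrite /quotm_scale; apply/quotm_pi_eq; rewrite -scalerBr.
rewrite -[mem_submodule W]/subm_pred; apply: rpredZ.
apply/quotm_pi_eq; by rewrite /quotm_pi reprK.
Qed.

Lemma quotm_piD x y : quotm_pi (x + y) = quotm_pi x + quotm_pi y.
Proof. by rewrite /quotm_pi raddfD. Qed.

Fact quotm_scalerA a b v : quotm_scale a (quotm_scale b v) = quotm_scale (a * b) v.
Proof. by have [x <-] := quotm_pi_surj v; rewrite -!quotm_piZ scalerA. Qed.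
Fact quotm_scale1r : left_id 1 quotm_scale.
Proof. by move=> v; have [x <-] := quotm_pi_surj v; rewrite -quotm_piZ scale1r. Qed.
Fact quotm_scalerDr : right_distributive quotm_scale +%R.
Proof.
move=> a v w; have [x <-] := quotm_pi_surj v; have [y <-] := quotm_pi_surj w.
by rewrite -quotm_piD -!quotm_piZ scalerDr quotm_piD.
Qed.
Fact quotm_scalerDl v : {morph quotm_scale^~ v : a b / a + b}.
Proof.
move=> a b; have [x <-] := quotm_pi_surj v.
by rewrite -!quotm_piZ scalerDl quotm_piD.
Qed.
HB.instance Definition _ := GRing.Zmodule_isLmodule.Build R quotm
  quotm_scalerA quotm_scale1r quotm_scalerDr quotm_scalerDl.

Lemma quotm_pi_linear : linear quotm_pi.
Proof. by move=> a x y; rewrite quotm_piD quotm_piZ. Qed.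

Definition quotm_proj : {linear V -> quotm} := Lin quotm_pi_linear.

Lemma quotm_proj_eq0 v : quotm_proj v = 0 <-> v \in mem_submodule W.
Proof.
have p0 : quotm_pi 0 = 0 by rewrite -[LHS](LinE quotm_pi_linear) linear0.
by rewrite [quotm_proj v]LinE -{2}[v]subr0 -quotm_pi_eq p0.
Qed.

End Submodule.

End ModuleConstructions.

(** * Kernels, cokernels and free modules *)

Section KernelCokernel.
Variables (R : pzRingType) (A B : lmodType R) (f : {linear A -> B}).

Fact kerm_closed : submod_closed [pred x | f x == 0].
Proof.
split=> [|a x y]; rewrite !inE ?linear0 //.
move=> /eqP fx /eqP fy.
by rewrite linearP fx fy scaler0 addr0.
Qed.
Definition kerm : lmodType R := subm (Submodule kerm_closed).
Definition kerm_incl : {linear kerm -> A} := subm_incl _.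

Fact imm_closed : submod_closed [pred y | `[< exists x, f x = y >]].
Proof.
split=> [|a x' y']; rewrite !inE; first by exists 0; rewrite linear0.
move=> [x <-] [y <-].
by exists (a *: x + y); rewrite linearP.
Qed.
Definition cokm : lmodType R := quotm (Submodule imm_closed).
Definition cokm_proj : {linear B -> cokm} := quotm_proj _.

Lemma kerm_incl_inj : injective kerm_incl.
Proof. exact: subm_incl_inj. Qed.

Lemma kerm_exact : exact_at kerm_incl f.
Proof.
by move=> x; rewrite -subm_inclP inE; split=> [->|/eqP].
Qed.

Lemma cokm_proj_surj y : exists x, cokm_proj x = y.
Proof. by have [x <-] := quotm_pi_surj y; exists x; rewrite LinE. Qed.

Lemma cokm_exact : exact_at f cokm_proj.
Proof.
by move=> x; rewrite quotm_proj_eq0 inE.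
Qed.

End KernelCokernel.

Section FreeModule.
Variables (R : pzRingType) (S : choiceType).

Fact finsupp_closed : submod_closed [pred x : S -> R^o |
  `[< exists l : seq S, forall s, s \notin l -> x s = 0 >]].
Proof.
split=> [|a x y]; rewrite !inE; first by exists [::].
move=> [l1 h1] [l2 h2]; exists (l1 ++ l2) => s.
rewrite mem_cat negb_or => /andP[n1 n2].
by rewrite fctE -[(a *: x) s]/(a *: x s) h1 // h2 // scaler0 addr0.
Qed.

Definition freem : lmodType R := subm (Submodule finsupp_closed).

Definition fcoef (x : freem) (s : S) : R := subm_val x s.

Lemma fcoefP a x y s : fcoef (a *: x + y) s = a * fcoef x s + fcoef y s.
Proof. by []. Qed.

Lemma fcoef_finite x : exists l : seq S, forall s, s \notin l -> fcoef x s = 0.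
Proof. by have := valP x; rewrite inE. Qed.

(** The list given by [fcoef_finite] may repeat entries and contain zeros of [x]; it is pruned to
    the exact support. *)
Definition fsupp (x : freem) : seq S :=
  undup [seq s <- sval (cid (fcoef_finite x)) | fcoef x s != 0].

Lemma mem_fsupp x s : (s \in fsupp x) = (fcoef x s != 0).
Proof.
rewrite mem_undup mem_filter; case: cid => l /= hl.
by case: eqP => //= /eqP n0; apply: contraNT n0 => /hl ->.
Qed.

(** Transparent, so that the coefficients of a generator compute. *)
Definition fgen (s : S) : freem.
Proof.
exists (fun s' => (s' == s)%:R : R^o); apply/asboolP; exists [:: s] => s'.
by rewrite inE => /negPf ->.
Defined.

Lemma fcoef_gen s s' : fcoef (fgen s) s' = (s' == s)%:R.
Proof. by []. Qed.

Lemma freem_eq (x y : freem) : fcoef x =1 fcoef y -> x = y.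
Proof. by move=> e; apply: val_inj; apply/funext => s; exact: e. Qed.

Section Extension.
Variables (N : lmodType R) (t : S -> N).

Definition fext_fun (x : freem) : N := \sum_(s <- fsupp x) fcoef x s *: t s.

Lemma fext_finite l x : uniq l -> {subset fsupp x <= l} ->
  fext_fun x = \sum_(s <- l) fcoef x s *: t s.
Proof.
move=> ul xl; rewrite (bigID (fun s => fcoef x s != 0)) /= [X in _ + X]big1.
  rewrite addr0 -big_filter; apply/perm_big/uniq_perm; rewrite ?undup_uniq ?filter_uniq //.
  move=> s; rewrite mem_filter mem_fsupp; case: (boolP (_ != 0)) => //= n0.
  by rewrite xl // mem_fsupp.
by move=> s; rewrite negbK => /eqP ->; rewrite scale0r.
Qed.

Lemma fext_linear : linear fext_fun.
Proof.
move=> a x y.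
pose l := undup (fsupp (a *: x + y) ++ fsupp x ++ fsupp y).
have ul : uniq l by exact: undup_uniq.
rewrite !(@fext_finite l) //; try by move=> s; rewrite /l mem_undup !mem_cat => ->; rewrite ?orbT.
rewrite scaler_sumr -big_split; apply: eq_bigr => s _.
by rewrite fcoefP scalerDl scalerA.
Qed.

Definition fext : {linear freem -> N} := Lin fext_linear.

Lemma fextE x : fext x = fext_fun x.
Proof. exact: LinE. Qed.

Lemma fext_gen s : fext (fgen s) = t s.
Proof.
rewrite fextE (@fext_finite [:: s]) // => [|s'].
  by rewrite big_seq1 fcoef_gen eqxx scale1r.
rewrite mem_fsupp fcoef_gen inE; case: (s' == s) => //.
by rewrite eqxx.
Qed.

End Extension.

Lemma eq_fext (N : lmodType R) (t t' : S -> N) x :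
  (forall s, s \in fsupp x -> t s = t' s) -> fext t x = fext t' x.
Proof. by move=> e; rewrite !fextE; apply: eq_big_seq => s /e ->. Qed.

(** Unlike in [fext_finite], [l] need not contain the support, provided [t] vanishes on what is
    missed. In [ph_extend] this cuts sums down to finitely many new generators. *)
Lemma fext_seq (N : lmodType R) (t : S -> N) (l : seq S) (x : freem) :
    uniq l -> (forall s, s \in fsupp x -> s \notin l -> t s = 0) ->
  fext t x = \sum_(s <- l) fcoef x s *: t s.
Proof.
move=> ul xl; pose l' := l ++ [seq s <- fsupp x | s \notin l].
rewrite fextE (@fext_finite _ _ l').
- rewrite big_cat /= [X in _ + X]big1_seq ?addr0 // => s.
  by rewrite mem_filter => /and3P[_ sl sx]; rewrite xl // scaler0.
- rewrite cat_uniq ul filter_uniq ?undup_uniq // andbT.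
  by apply/hasPn => s; rewrite mem_filter => /andP[].
- move=> s sx; rewrite mem_cat mem_filter sx andbT.
  by case: (s \in l).
Qed.

Lemma fext_add (N : lmodType R) (t t' : S -> N) x : fext (fun s => t s + t' s) x = fext t x + fext t' x.
Proof.
rewrite !fextE /fext_fun -big_split; apply: eq_bigr => s _.
by rewrite scalerDr.
Qed.

Lemma fext_eta (N : lmodType R) (g : {linear freem -> N}) x :
  g x = fext (fun s => g (fgen s)) x.
Proof.
rewrite fextE /fext_fun.
under eq_bigr => s _ do rewrite -linearZ.
rewrite -linear_sum; congr (g _); apply: freem_eq => s.
have -> : fcoef (\sum_(s <- fsupp x) fcoef x s *: fgen s) s =
    \sum_(s' <- fsupp x) fcoef x s' * (s == s')%:R.
  elim: (fsupp x) => [|s' l IH]; first by rewrite !big_nil.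
  by rewrite !big_cons fcoefP IH.
case: (boolP (s \in fsupp x)) => sx.
  rewrite (bigD1_seq s) ?undup_uniq //= eqxx mulr1 big1 ?addr0 // => s'.
  by rewrite eq_sym => /negPf ->; rewrite mulr0.
rewrite big_seq big1.
  by apply/eqP; rewrite mem_fsupp negbK in sx.
by move=> s' s'x; case: eqP => [e|_]; [rewrite e s'x in sx | rewrite mulr0].
Qed.

Lemma freem_linear_eq (N : lmodType R) (g h : {linear freem -> N}) :
  (forall s, g (fgen s) = h (fgen s)) -> forall x, g x = h x.
Proof. by move=> e x; rewrite (fext_eta g) (fext_eta h); apply: eq_fext. Qed.

Lemma freem_projective : module_projective freem.
Proof.
move=> A B g f gs; have /choice[h gh] := fun s => gs (f (fgen s)).
exists (fext h) => x; rewrite (fext_eta f).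
rewrite [LHS](fext_eta (g \o fext h)%FUN) /=.
by apply: eq_fext => s _ /=; rewrite fext_gen gh.
Qed.

End FreeModule.

(** * Vanishing of Ext^1 *)

Section Ext1.
Variable R : pzRingType.
Implicit Types A B C D E F G I K M N P : lmodType R.

Fact zero_linear (A B : lmodType R) : linear (fun _ : A => 0 : B).
Proof. by move=> a x y; rewrite (scaler0 B) addr0. Qed.

Fact id_linear (A : lmodType R) : linear (fun x : A => x).
Proof. by []. Qed.

Definition short_exact A B C (i : {linear A -> B}) (p : {linear B -> C}) :=
  [/\ injective i, exact_at i p & forall c, exists b, p b = c].

Lemma short_exact_comp0 A B C (i : {linear A -> B}) (p : {linear B -> C}) :
  short_exact i p -> forall a, p (i a) = 0.
Proof. by case=> _ e _ a; apply/e; exists a. Qed.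

Lemma kerm_short_exact A B (f : {linear A -> B}) :
  (forall b, exists a, f a = b) -> short_exact (kerm_incl f) f.
Proof. by split=> //; [exact: kerm_incl_inj | exact: kerm_exact]. Qed.

Lemma cokm_short_exact A B (f : {linear A -> B}) :
  injective f -> short_exact f (cokm_proj f).
Proof. by split=> //; [exact: cokm_exact | exact: cokm_proj_surj]. Qed.

(* The vanishing of Ext^1(M, D). *)
Definition ext1 M D := forall A B (i : {linear A -> B}) (p : {linear B -> M}),
  short_exact i p -> forall f : {linear A -> D},
  exists h : {linear B -> D}, forall a, h (i a) = f a.

Lemma ext1_from_presentation K F M (i : {linear K -> F}) (p : {linear F -> M}) D :
    short_exact i p -> module_projective F ->
    (forall f : {linear K -> D}, exists h : {linear F -> D}, forall k, h (i k) = f k) ->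
  ext1 M D.
Proof.
move=> [ii ip sp] prF ex A B j q [ij jq sq] f.
have [l ql] := prF B M q p sq.
have [k jk] : exists k : {linear K -> A}, forall x, j (k x) = l (i x).
  apply: (factor_inj (u := l \o i)%FUN) => // x /=.
  by apply/jq; rewrite ql; apply/ip; exists x.
have [g gi] := ex (f \o k)%FUN.
(* [B] is the pushout of [A] and [F] along [K]: the map (a, x) to [j a + l x] is onto, and its
   kernel comes from [K], where [f] and [g] agree. Hence they glue to a map on [B]. *)
have sL : linear (fun x : (A * F)%type => j x.1 + l x.2).
  by move=> a x y /=; rewrite !linearP scalerDr addrACA.
have tL : linear (fun x : (A * F)%type => f x.1 + g x.2).
  by move=> a x y /=; rewrite !linearP scalerDr addrACA.
have [h hE] : exists h : {linear B -> D}, forall x, h (Lin sL x) = Lin tL x.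
  apply: factor_surj => [b|[a x]]; last rewrite !LinE /= => e.
    have [x pxb] := sp (q b).
    have /jq[a ja] : q (b - l x) = 0 by rewrite linearB ql pxb subrr.
    by exists (a, x); rewrite LinE /= ja subrK.
  have /ip[y yx] : p x = 0.
    by rewrite -ql -[RHS](linear0 q) -e linearD (short_exact_comp0 (And3 ij jq sq)) add0r.
  have -> : a = - k y by apply: ij; rewrite linearN jk yx; apply/eqP; rewrite -addr_eq0 e.
  by rewrite -yx gi linearN /= addNr.
exists h => a; have := hE (a, 0); by rewrite !LinE /= !linear0 !addr0.
Qed.

(** Projectivity of [F] lifts [g \o p] to [I]. On the kernel of [p] the lift takes values in [D];
    the vanishing of Ext extends this restriction to [F], and after subtracting the extension the
    lift factors through [p]. *)
Lemma ext1_lift D I C (j : {linear D -> I}) (q : {linear I -> C}) M :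
    short_exact j q -> ext1 M D -> forall g : {linear M -> C},
  (exists F (p : {linear F -> M}),
      module_projective F /\ (forall m, exists x, p x = m)) ->
  exists h : {linear M -> I}, forall m, q (h m) = g m.
Proof.
move=> [ij jq sq] eMD g [F [p [prF sp]]].
have [l ql] := prF I C q (g \o p)%FUN sq.
have [f jf] : exists f : {linear kerm p -> D}, forall x, j (f x) = l (kerm_incl p x).
  apply: (factor_inj (u := l \o kerm_incl p)%FUN) => // x /=.
  apply/jq; rewrite ql /=.
  by rewrite (short_exact_comp0 (kerm_short_exact sp)) linear0.
have [f' f'E] := eMD _ _ _ _ (kerm_short_exact sp) f.
have dL : linear (fun x => l x - j (f' x)).
  by move=> a x y; rewrite !linearP /= scalerDr addrACA.
have [h hE] : exists h : {linear M -> I}, forall x, h (p x) = Lin dL x.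
  apply: factor_surj => // x /kerm_exact[y <-].
  by rewrite LinE f'E jf subrr.
exists h => m; have [x <-] := sp m.
by rewrite hE LinE linearB ql (short_exact_comp0 (And3 ij jq sq)) subr0.
Qed.

(** Injectivity extends [f] to a map [B -> I], which induces [M -> C]; subtracting a lift of the
    latter moves the extension into [D]. *)
Lemma ext1_of_lift D I C (j : {linear D -> I}) (q : {linear I -> C}) M :
    short_exact j q -> module_injective I ->
    (forall g : {linear M -> C}, exists h : {linear M -> I}, forall m, q (h m) = g m) ->
  ext1 M D.
Proof.
move=> sjq inI li A B i p sip f; have [ij jq sq] := sjq; have [ii ip sp] := sip.
have [u ui] := inI A B i (j \o f)%FUN ii.
have [g gp] : exists g : {linear M -> C}, forall b, g (p b) = q (u b).
  apply: (factor_surj (g := q \o u)%FUN) => // b /ip[a <-] /=.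
  by rewrite ui /= (short_exact_comp0 sjq).
have [v qv] := li g.
have dL : linear (fun x => u x - v (p x)).
  by move=> a x y; rewrite !linearP /= scalerDr addrACA.
have [h jh] : exists h : {linear B -> D}, forall b, j (h b) = Lin dL b.
  apply: factor_inj => // b; apply/jq; by rewrite LinE linearB qv gp subrr.
exists h => a; apply: ij; rewrite jh LinE ui /=.
by rewrite (short_exact_comp0 sip) linear0 subr0.
Qed.

Definition free_cover M : {linear freem R M -> M} := fext (fun m : M => m).

Lemma free_cover_surj M m : exists x, free_cover M x = m.
Proof. by exists (fgen R m); rewrite /free_cover fext_gen. Qed.

Definition syz M : lmodType R := kerm (free_cover M).

Lemma syz_short_exact M : short_exact (kerm_incl (free_cover M)) (free_cover M).
Proof. exact/kerm_short_exact/free_cover_surj. Qed.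

Lemma ext1_liftP D I C (j : {linear D -> I}) (q : {linear I -> C}) M :
    short_exact j q -> module_injective I -> ext1 M D <->
  forall g : {linear M -> C}, exists h : {linear M -> I}, forall m, q (h m) = g m.
Proof.
move=> sjq inI; split=> [e g|]; last exact: ext1_of_lift sjq inI.
apply: ext1_lift sjq e g _; exists (freem R M), (free_cover M).
by split; [exact: freem_projective | exact: free_cover_surj].
Qed.

(** Dimension shifting in both variables at once: each side amounts to every map from [K] to [C]
    factoring as [K -> F -> I -> C]. *)
Lemma ext1_shift K F M (i : {linear K -> F}) (p : {linear F -> M})
    D I C (j : {linear D -> I}) (q : {linear I -> C}) :
    short_exact i p -> module_projective F ->
    short_exact j q -> module_injective I ->
  ext1 K D <-> ext1 M C.
Proof.
move=> sip prF sjq inI; have [ii _ _] := sip; have [_ _ sq] := sjq.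
rewrite (ext1_liftP K sjq inI); split=> [li|e].
  apply: (ext1_from_presentation sip prF) => g.
  have [h qh] := li g; have [h' h'i] := inI _ _ i h ii.
  by exists (q \o h')%FUN => k /=; rewrite h'i qh.
move=> g; have [g' g'i] := e _ _ _ _ sip g.
have [h qh] := prF _ _ q g' sq.
by exists (h \o i)%FUN => k /=; rewrite qh g'i.
Qed.

Lemma projective_ext1 M : module_projective M <-> forall D, ext1 M D.
Proof.
split=> [prM D|e A B g f sg].
  (* [M] is presented by itself, with the zero module ['rV[R]_0] as kernel. *)
  apply: (@ext1_from_presentation _ _ _ (Lin (@zero_linear 'rV[R]_0 M)) (Lin (@id_linear M))) => //.
  - split=> [x y _|x|x]; first by rewrite [x]thinmx0 [y]thinmx0.
    + by rewrite LinE; split=> [->|[y <-]]; [exists 0|]; rewrite LinE.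
    + by exists x; rewrite LinE.
  - move=> f; exists (Lin (@zero_linear M D)) => k.
    by rewrite LinE [k]thinmx0 linear0.
(* A lift over the free cover is corrected, as in [ext1_lift], until it kills [syz M]; here the role
   of [D] is played by the kernel of [g]. *)
have [l gl] := @freem_projective R M A B g (f \o free_cover M)%FUN sg.
have [u gu] : exists u : {linear syz M -> kerm g},
    forall x, kerm_incl g (u x) = l (kerm_incl (free_cover M) x).
  apply: (factor_inj (u := l \o kerm_incl (free_cover M))%FUN); first exact: kerm_incl_inj.
  move=> x; apply/kerm_exact; rewrite /= gl /=.
  by rewrite (short_exact_comp0 (syz_short_exact M)) linear0.
have [u' u'E] := e _ _ _ _ _ (syz_short_exact M) u.
have dL : linear (fun x => l x - kerm_incl g (u' x)).
  by move=> a x y; rewrite !linearP /= scalerDr addrACA.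
have [h hE] : exists h : {linear M -> A}, forall x, h (free_cover M x) = Lin dL x.
  apply: factor_surj; first exact: free_cover_surj.
  by move=> x /kerm_exact[y <-]; rewrite LinE u'E gu subrr.
exists h => m; have [x <-] := free_cover_surj m.
by rewrite hE LinE linearB gl (short_exact_comp0 (kerm_short_exact sg)) subr0.
Qed.

Lemma injective_ext1 D : module_injective D <-> forall M, ext1 M D.
Proof.
split=> [inD M A B i p [ii _ _] f|e A B g f ig]; first exact: inD.
exact: e (cokm_short_exact ig) f.
Qed.

Lemma projective_prod P Q : module_projective P -> module_projective Q ->
  module_projective (P * Q)%type.
Proof.
move=> prP prQ A B g f sg.
have L1 : linear (fun x : P => (x, 0) : (P * Q)%type).
  by move=> a x y; congr pair; rewrite /= scaler0 addr0.
have L2 : linear (fun x : Q => (0, x) : (P * Q)%type).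
  by move=> a x y; congr pair; rewrite /= scaler0 addr0.
have [h1 gh1] := prP _ _ g (f \o Lin L1)%FUN sg.
have [h2 gh2] := prQ _ _ g (f \o Lin L2)%FUN sg.
have hL : linear (fun x : (P * Q)%type => h1 x.1 + h2 x.2).
  by move=> a x y /=; rewrite !linearP scalerDr addrACA.
exists (Lin hL) => -[x y]; rewrite LinE linearD gh1 gh2 /= !LinE -linearD.
by congr (f (_, _)); rewrite /= ?addr0 ?add0r.
Qed.

(** [B] is covered by the product of the free covers of [A] and [C]. The kernel [B'] of this cover
    is not [syz B] in general, so the cover is returned along with it. *)
Lemma horseshoe A B C (i : {linear A -> B}) (p : {linear B -> C}) :
    short_exact i p ->
  exists B' F (j : {linear B' -> F}) (q : {linear F -> B})
      (i' : {linear syz A -> B'}) (p' : {linear B' -> syz C}),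
    [/\ module_projective F, short_exact j q & short_exact i' p'].
Proof.
move=> sip; have [ii ip sp] := sip.
have [c pc] := @freem_projective R C _ _ p (free_cover C) sp.
pose F : lmodType R := (freem R A * freem R C)%type.
have qL : linear (fun x : F => i (free_cover A x.1) + c x.2).
  by move=> a x y /=; rewrite !linearP scalerDr addrACA.
have sq b : exists x, Lin qL x = b.
  have [y ey] := free_cover_surj (p b).
  have /ip[a ia] : p (b - c y) = 0 by rewrite linearB pc ey subrr.
  have [x ex] := free_cover_surj a.
  by exists (x, y); rewrite (LinE qL) /= ex ia subrK.
have L1 : linear (fun x : freem R A => (x, 0) : F).
  by move=> a x y; congr pair; rewrite /= scaler0 addr0.
have L2 : linear (fun x : F => x.2) by [].
have [i' i'E0] : exists i' : {linear syz A -> kerm (Lin qL)},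
    forall x, kerm_incl (Lin qL) (i' x) = (Lin L1 \o kerm_incl (free_cover A))%FUN x.
  apply: factor_inj => [|x]; first exact: kerm_incl_inj.
  apply/kerm_exact; rewrite /= (LinE L1) (LinE qL) /= linear0 addr0.
  by rewrite (short_exact_comp0 (syz_short_exact A)) linear0.
have i'E x : kerm_incl (Lin qL) (i' x) = (kerm_incl (free_cover A) x, 0).
  by rewrite i'E0 /= (LinE L1).
have [p' p'E0] : exists p' : {linear kerm (Lin qL) -> syz C},
    forall x, kerm_incl (free_cover C) (p' x) = (Lin L2 \o kerm_incl (Lin qL))%FUN x.
  apply: factor_inj => [|x]; first exact: kerm_incl_inj.
  apply/kerm_exact; rewrite /= (LinE L2) -pc.
  have := short_exact_comp0 (kerm_short_exact sq) x; rewrite (LinE qL) => /(congr1 p).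
  by rewrite linear0 linearD (short_exact_comp0 sip) add0r.
have p'E x : kerm_incl (free_cover C) (p' x) = (kerm_incl (Lin qL) x).2.
  by rewrite p'E0 /= (LinE L2).
exists (kerm (Lin qL)), F, (kerm_incl (Lin qL)), (Lin qL), i', p'.
split; first exact/projective_prod/freem_projective/freem_projective.
  exact: kerm_short_exact.
split.
- move=> x y /(congr1 (kerm_incl (Lin qL))); rewrite !i'E => -[].
  exact: kerm_incl_inj.
- move=> x; split=> [p'x|[y yx]]; last first.
    by apply: (@kerm_incl_inj _ _ _ (free_cover C)); rewrite p'E -yx i'E linear0.
  have x2 : (kerm_incl (Lin qL) x).2 = 0 by rewrite -p'E p'x linear0.
  have := short_exact_comp0 (kerm_short_exact sq) x; rewrite (LinE qL) x2 linear0 addr0.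
  rewrite -[RHS](linear0 i) => /ii /kerm_exact[y yx].
  exists y; apply: (@kerm_incl_inj _ _ _ (Lin qL)); rewrite i'E yx.
  by rewrite [RHS]surjective_pairing x2.
- move=> y.
  have /ip[a ia] : p (c (kerm_incl (free_cover C) y)) = 0.
    by rewrite pc (short_exact_comp0 (syz_short_exact C)).
  have [x ex] := free_cover_surj a.
  have /kerm_exact[z zE] : Lin qL (- x, kerm_incl (free_cover C) y) = 0.
    by rewrite (LinE qL) /= linearN ex linearN ia addNr.
  exists z; apply: (@kerm_incl_inj _ _ _ (free_cover C)); by rewrite p'E zE.
Qed.

End Ext1.

(** * Characters *)

Section DivisibleExtension.
Variable T : zmodType.
Hypothesis T_div : forall (d : nat) (t : T), (0 < d)%N -> exists t', t' *+ d = t.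

(** [G] is the graph of a partial homomorphism, and [t0] is a value at [b] compatible with it. *)
Lemma divisible_step (B : zmodType) (G : set (B * T)) (b : B) :
    (forall p q, G p -> G q -> G (p - q)) -> G 0 ->
    (forall t, G (0, t) -> t = 0) ->
  exists t0, forall k s, G (b *~ k, s) -> s = t0 *~ k.
Proof.
move=> GB G0 Gf.
have GN p : G p -> G (- p) by move=> /(GB _ _ G0); rewrite sub0r.
have GD p q : G p -> G q -> G (p + q) by move=> Gp /GN /(GB _ _ Gp); rewrite opprK.
have GZ k p : G p -> G (p *~ k).
  move=> Gp; have Gn n : G (p *+ n).
    by elim: n => [|n IH]; rewrite ?mulr0n // mulrS; exact: GD.
  by case: k => n; rewrite ?NegzE ?mulrNz -?pmulrn //; exact: GN.
case: (pselect (exists d, (0 < d)%N && `[< exists t, G (b *+ d, t) >])) => [exd|nod].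
  (* The multiples of [b] in the domain are those of the least positive one, [b *+ d], so any [d]-th
     part of its value will do. *)
  case: (ex_minnP exd) => d /andP[d0 /asboolP[td Gtd]] dmin.
  have [t0 t0d] := T_div td d0; exists t0 => k s Gks.
  have r0 : (0 <= (k %% d)%Z) by rewrite modz_ge0 // eqz_nat -lt0n.
  have rd : ((k %% d)%Z < d) by rewrite ltz_pmod // ltz_nat.
  move: (divz_eq k d) r0 rd; move: (k %/ d)%Z (k %% d)%Z => q r kE.
  subst k => r0 rd.
  have bE : b *~ (q * d + r) = b *+ d *~ q + b *~ r.
    by rewrite mulrzDr pmulrn -mulrzA mulrC.
  have Gr : G (b *~ r, s - td *~ q).
    have := GB _ _ Gks (GZ q _ Gtd); congr G.
    have -> : (b *+ d, td) *~ q = (b *+ d *~ q, td *~ q).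
      by rewrite [LHS]surjective_pairing (raddfMz fst) (raddfMz snd).
    by congr pair; rewrite /= bE addrAC subrr add0r.
  case: r r0 rd {Gks bE} Gr => // r _; rewrite ltz_nat; case: r => [|r] rd Gr.
    move: Gr; rewrite mulr0z => /Gf /eqP; rewrite subr_eq0 => /eqP ->.
    by rewrite addr0 -t0d pmulrn -mulrzA mulrC.
  have := dmin r.+1; rewrite (leqNgt d) rd /= => h.
  by have := h (asboolT (ex_intro _ _ Gr)).
(* No nonzero multiple of [b] lies in the domain, so the value at [b] is free. *)
exists 0 => k s; case: k => [[|n]|n].
- by rewrite mulr0z => /Gf ->; rewrite mul0rz.
- move=> h; case: nod; exists n.+1; apply/asboolP; exists s; exact: h.
- move=> h; case: nod; exists n.+1; apply/asboolP; exists (- s).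
  by have := GN _ h; congr G; congr pair; rewrite /= NegzE mulrNz opprK.
Qed.

Lemma divisible_extension (B : zmodType) (G0 : set (B * T)) :
    (forall p q, G0 p -> G0 q -> G0 (p - q)) -> G0 0 ->
    (forall t, G0 (0, t) -> t = 0) ->
  exists chi : B -> T, {morph chi : x y / x + y} /\
    forall x t, G0 (x, t) -> chi x = t.
Proof.
move=> G0B G00 G0f.
pose good (G : set (B * T)) := [/\ forall p q, G p -> G q -> G (p - q),
  G0 `<=` G & forall t, G (0, t) -> t = 0]%classic.
(* Zorn's lemma is applied to sets whose union with [G0] is good, so that the empty chain has an
   admissible union as well. *)
have [F FP Ftot|G [[GB GG0 Gf] Gmax]] :=
    @Zorn_bigcup (B * T)%type (fun X => good (X `|` G0)%classic).
  split.
  - move=> p q [[X FX Xp]|Gp] [[Y FY Yq]|Gq].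
    + have [Z [FZ Zp Zq]] : exists Z, [/\ F Z, Z p & Z q].
        case: (Ftot _ _ FX FY) => [XY|YX]; [exists Y|exists X]; split=> //.
          exact: XY.
        exact: YX.
      have [h _ _] := FP _ FZ; case: (h p q); [by left|by left| |by right].
      by move=> ?; left; exists Z.
    + have [h _ _] := FP _ FX; case: (h p q); [by left|by right| |by right].
      by move=> ?; left; exists X.
    + have [h _ _] := FP _ FY; case: (h p q); [by right|by left| |by right].
      by move=> ?; left; exists Y.
    + by right; exact: G0B.
  - by move=> p; right.
  - move=> t [[X FX Xt]|]; last exact: G0f.
    by have [_ _ h] := FP _ FX; apply: h; left.
pose H := (G `|` G0)%classic.
have tot b : exists t, H (b, t).
  case: (pselect (exists t, H (b, t))) => // nb; exfalso.
  have [t0 t0P] := divisible_step b GB (or_intror G00) Gf.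
  (* The graph enlarged by the multiples of (b, t0), which contradicts maximality. *)
  pose G' : set (B * T) := fun p => exists k q, H q /\ p = q + (b *~ k, t0 *~ k).
  have HG' : (H `<=` G')%classic.
    by move=> p Hp; exists 0, p; split=> //; rewrite !mulr0z addr0.
  have G'E : (G' `|` G0 = G')%classic.
    by apply/seteqP; split=> p; [case=> // G0p; apply: HG'; right | left].
  apply: (Gmax G'); last first.
    rewrite G'E; split=> [_ _ [k [q [Hq ->]]] [l [r [Hr ->]]]|p G0p|t].
    - exists (k - l), (q - r); split; first exact: GB.
      by rewrite !mulrzBr opprD addrACA; congr (_ + (_, _)).
    - by apply: HG'; right.
    - move=> [k [[x s] [Hq [xE ->]]]].
      have : H (b *~ (- k), s).
        by rewrite mulrNz -[_ *~ k](addKr x) -xE addr0 opprK.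
      by move=> /t0P ->; rewrite mulrNz addNr.
  split; first by move=> p Gp; apply: HG'; left.
  move=> /(_ (b, t0)) h; apply: nb; exists t0; left; apply: h.
  by exists 1, 0; split; [right|rewrite !mulr1z add0r].
have [chi chiP] := choice tot.
have fE x t t' : H (x, t) -> H (x, t') -> t = t'.
  move=> h1 h2; apply/eqP; rewrite -subr_eq0; apply/eqP/Gf.
  by have := GB _ _ h1 h2; rewrite -[(x, t) - _]/(x - x, t - t') subrr.
exists chi; split=> [x y|x t G0x]; last first.
  by apply: (fE x); [exact: chiP|right].
apply: (fE (x + y)); first exact: chiP.
have H0 : H 0 by right.
have := GB _ _ (chiP x) (GB _ _ H0 (chiP y)).
by rewrite sub0r opprK.
Qed.

Hypothesis T_torsion : forall d, (1 < d)%N -> exists2 t : T, t != 0 & t *+ d = 0.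

Lemma divisible_separation (B : zmodType) (H : set B) (c : B) :
    H 0 -> (forall x y, H x -> H y -> H (x - y)) -> ~ H c ->
  exists chi : B -> T, [/\ {morph chi : x y / x + y},
    forall x, H x -> chi x = 0 & chi c <> 0].
Proof.
move=> H0 HB Hc.
have HN p : H p -> H (- p) by move=> /(HB _ _ H0); rewrite sub0r.
have HD p q : H p -> H q -> H (p + q) by move=> Gp /HN /(HB _ _ Gp); rewrite opprK.
have Hn n p : H p -> H (p *+ n).
  by move=> Hp; elim: n => [|n IH]; rewrite ?mulr0n // mulrS; exact: HD.
(* [t] is the value intended at [c]. If [d] is the least positive number with [c *+ d] in [H], a
   nonzero element killed by [d] is suitable; if there is none, any nonzero element is. *)
have [t tn0 tP] : exists2 t : T, t != 0 & forall k : int, H (c *~ k) -> t *~ k = 0.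
  have abs (t : T) : (forall n : nat, H (c *+ n) -> t *+ n = 0) ->
      forall k : int, H (c *~ k) -> t *~ k = 0.
    move=> h [] n; first exact: h.
    by rewrite NegzE !mulrNz => /HN; rewrite opprK => /h tn; rewrite -[t *~ _]/(t *+ n.+1) tn oppr0.
  case: (pselect (exists d, (0 < d)%N && `[< H (c *+ d) >])) => [exd|nod].
    case: (ex_minnP exd) => d /andP[d0 /asboolP Hd] dmin.
    have d1 : (1 < d)%N.
      by rewrite ltn_neqAle d0 andbT eq_sym; apply/eqP => d1; apply: Hc; rewrite d1 in Hd.
    have [t tn0 td] := T_torsion d1; exists t => //; apply: abs => n Hcn.
    have : H (c *+ (n %% d)).
      have := HB _ _ Hcn (Hn (n %/ d)%N _ Hd); rewrite -mulrnA mulnC.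
      by rewrite {1}(divn_eq n d) mulrnDr addrAC subrr add0r.
    have := dmin (n %% d)%N; rewrite (leqNgt d) ltn_mod d0 /=.
    rewrite lt0n; case: eqP => [nd0 _ _|_ h Hm] /=; last first.
      by have := h (asboolT Hm).
    by rewrite (divn_eq n d) nd0 addn0 mulnC mulrnA td mul0rn.
  have [t tn0 _] := @T_torsion 2 isT; exists t => //; apply: abs => -[//|n] h.
  by case: nod; exists n.+1; apply/asboolP.
(* The partial homomorphism on [H] plus the multiples of [c] that kills [H] and sends [c] to [t]. *)
have [|||chi [chiD chiE]] := @divisible_extension B
    (fun p => exists k x, H x /\ p = (x + c *~ k, t *~ k)).
- move=> _ _ [k [x [Hx ->]]] [l [y [Hy ->]]]; exists (k - l), (x - y).
  split; first exact: HB.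
  by rewrite !mulrzBr; congr (_, _); rewrite /= opprD addrACA.
- by exists 0, 0; split=> //; rewrite !mulr0z addr0.
- move=> s [k [x [Hx [xE ->]]]]; apply: tP.
  by rewrite -[_ *~ k](addKr x) -xE addr0; exact: HN.
exists chi; split=> // [x Hx|].
  by apply: chiE; exists 0, x; split=> //; rewrite !mulr0z addr0.
rewrite (chiE c t); last by exists 1, 0; rewrite !mulr1z add0r.
exact/eqP.
Qed.

End DivisibleExtension.

(** * The group Q/Z: divisible, with torsion of every order *)

Definition rat_int : {pred rat} := fun x => x \is a Num.int.

Fact rat_int_closed : zmod_closed rat_int.
Proof.
by split=> [|x y]; rewrite -!topredE /=; [exact: rpred0 | exact: rpredB].
Qed.

HB.instance Definition _ := GRing.isZmodClosed.Build rat rat_int rat_int_closed.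

Definition QZ : zmodType := Quotient.quot rat_int.

Definition QZ_pi (x : rat) : QZ := (\pi_(Quotient.quot rat_int) x)%qT.

Lemma QZ_piMn x n : QZ_pi x *+ n = QZ_pi (x *+ n).
Proof. by rewrite /QZ_pi raddfMn. Qed.

Lemma QZ_pi_eq0 x : (QZ_pi x == 0) = (x \is a Num.int).
Proof.
have <- : QZ_pi 0 = 0 by rewrite /QZ_pi raddf0.
by rewrite -(Quotient.idealrBE rat_int) subr0.
Qed.

Lemma QZ_div (d : nat) (t : QZ) : (0 < d)%N -> exists t', t' *+ d = t.
Proof.
move=> d0; have <- : QZ_pi (repr t) = t by rewrite /QZ_pi reprK.
exists (QZ_pi (repr t / d%:R)).
by rewrite QZ_piMn -(mulr_natr (_ / _)) divfK // pnatr_eq0 -lt0n.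
Qed.

Lemma QZ_torsion d : (1 < d)%N -> exists2 t : QZ, t != 0 & t *+ d = 0.
Proof.
move=> d1; have d0 : (d%:R : rat) != 0 by rewrite pnatr_eq0 -lt0n ltnW.
exists (QZ_pi d%:R^-1); last first.
  by apply/eqP; rewrite QZ_piMn -(mulr_natr _^-1) mulVf // QZ_pi_eq0 rpred1.
rewrite QZ_pi_eq0; apply/negP => /intrP[m /(congr1 ( *%R d%:R))].
rewrite divff // -[d%:R]/(d%:Z%:~R) -intrM => /eqP; rewrite eq_sym.
rewrite -[1 : rat]/(1%:~R) eqr_int => /eqP /(congr1 absz).
rewrite abszM /= => /eqP; rewrite muln_eq1 => /andP[/eqP e _].
by rewrite e in d1.
Qed.

(** * Character modules twisted by an anti-homomorphism *)

Section Dual.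
Variable R : pzRingType.

(** A ring morphism from R to its opposite, read as a map on the common carrier. *)
Record antihom := Antihom {
  antihom_fun :> R -> R;
  antihom1 : antihom_fun 1 = 1;
  antihomD : {morph antihom_fun : a b / a + b};
  antihomM : forall a b, antihom_fun (a * b) = antihom_fun b * antihom_fun a }.

Variable sigma : antihom.

Section DualModule.
Variable M : lmodType R.

Definition char_pred : {pred M -> QZ} :=
  fun chi => `[< {morph chi : x y / x + y} >].

Fact char_pred_closed : zmod_closed char_pred.
Proof.
split=> [|f g]; rewrite -!topredE /= !asboolE.
  by move=> x y; rewrite addr0.
by move=> fD gD x y; rewrite !fctE fD gD opprD addrACA.
Qed.
HB.instance Definition _ :=
  GRing.isZmodClosed.Build (M -> QZ) char_pred char_pred_closed.

Record char : Type := Char { char_fun : M -> QZ; _ : char_fun \in char_pred }.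
HB.instance Definition _ := [isSub for char_fun].
HB.instance Definition _ := [Choice of char by <:].
HB.instance Definition _ := [SubChoice_isSubZmodule of char by <:].

Lemma charD (chi : char) x y : char_fun chi (x + y) = char_fun chi x + char_fun chi y.
Proof. by have := valP chi; rewrite -topredE /= asboolE; apply. Qed.

Lemma mk_char (f : M -> QZ) : {morph f : x y / x + y} ->
  exists chi : char, char_fun chi = f.
Proof. by move=> fD; exists (Char (asboolT fD)). Qed.

Lemma char0 (chi : char) : char_fun chi 0 = 0.
Proof. by apply: (addrI (char_fun chi 0)); rewrite -charD !addr0. Qed.

Lemma charB (chi : char) x y : char_fun chi (x - y) = char_fun chi x - char_fun chi y.
Proof. by apply: (addIr (char_fun chi y)); rewrite -charD !subrK. Qed.

Lemma char_eq (chi psi : char) : char_fun chi =1 char_fun psi -> chi = psi.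
Proof. by move=> e; apply/val_inj/funext. Qed.

(* The antihomomorphism sigma turns the natural right R-module structure of the
   character group into a left one. *)
Definition dual of antihom : Type := char.
HB.instance Definition _ := GRing.Zmodule.on (dual sigma).

Fact char_scale_subproof (a : R) (chi : dual sigma) :
  (fun m => char_fun chi (sigma a *: m)) \in char_pred.
Proof. by rewrite -topredE /= asboolE => x y; rewrite scalerDr charD. Qed.

Definition char_scale (a : R) (chi : dual sigma) : dual sigma :=
  Char (char_scale_subproof a chi).

Fact char_scalerA a b v : char_scale a (char_scale b v) = char_scale (a * b) v.
Proof. by apply: char_eq => m /=; rewrite antihomM scalerA. Qed.
Fact char_scale1r : left_id 1 char_scale.
Proof. by move=> v; apply: char_eq => m /=; rewrite antihom1 scale1r. Qed.
Fact char_scalerDr : right_distributive char_scale +%R.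
Proof. by move=> a v w; apply: char_eq. Qed.
Fact char_scalerDl v : {morph char_scale^~ v : a b / a + b}.
Proof. by move=> a b; apply: char_eq => m /=; rewrite antihomD scalerDl charD. Qed.
HB.instance Definition _ := GRing.Zmodule_isLmodule.Build R (dual sigma)
  char_scalerA char_scale1r char_scalerDr char_scalerDl.

Lemma char_funZ a (chi : dual sigma) m : char_fun (a *: chi) m = char_fun chi (sigma a *: m).
Proof. by []. Qed.

End DualModule.

Fact dual_map_subproof (M N : lmodType R) (f : {linear M -> N}) (chi : dual N sigma) :
  (fun m => char_fun chi (f m)) \in @char_pred M.
Proof. by rewrite -topredE /= asboolE => x y; rewrite linearD charD. Qed.

Fact dual_map_linear (M N : lmodType R) (f : {linear M -> N}) :
  linear (fun chi : dual N sigma => Char (dual_map_subproof f chi) : dual M sigma).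
Proof.
move=> a x y; apply: char_eq => m.
by rewrite -[LHS]/(char_fun x (sigma a *: f m) + char_fun y (f m)) -linearZ.
Qed.

Definition dual_map (M N : lmodType R) (f : {linear M -> N}) :
  {linear dual N sigma -> dual M sigma} := Lin (dual_map_linear f).

Lemma dual_mapE (M N : lmodType R) (f : {linear M -> N}) chi m :
  char_fun (dual_map f chi) m = char_fun chi (f m).
Proof. by rewrite LinE. Qed.

Lemma char_extension (A B : lmodType R) (i : {linear A -> B}) (chi : A -> QZ) :
    injective i -> {morph chi : x y / x + y} ->
  exists psi : B -> QZ, {morph psi : x y / x + y} /\ forall a, psi (i a) = chi a.
Proof.
move=> ii chiD.
have chi0 : chi 0 = 0 by apply: (addrI (chi 0)); rewrite -chiD !addr0.
have chiB x y : chi (x - y) = chi x - chi y.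
  by apply: (addIr (chi y)); rewrite -chiD !subrK.
have [|||psi [psiD psiE]] := @divisible_extension QZ QZ_div B
    (fun p => exists a, p = (i a, chi a)).
- by move=> _ _ [a ->] [b ->]; exists (a - b); rewrite linearB chiB.
- by exists 0; rewrite linear0 chi0.
- by move=> t [a [/esym]]; rewrite -[RHS](linear0 i) => /ii -> ->.
by exists psi; split=> // a; apply: psiE; exists a.
Qed.

(** Restriction along [i] is onto because Q/Z is divisible; a character killing the image of [i]
    descends along [p]. *)
Lemma dual_short_exact (A B C : lmodType R) (i : {linear A -> B}) (p : {linear B -> C}) :
  short_exact i p -> short_exact (dual_map p) (dual_map i).
Proof.
move=> sip; have [ii ip sp] := sip; split.
- move=> x y e; apply: char_eq => c; have [b <-] := sp c.
  by rewrite -!dual_mapE e.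
- move=> chi; split=> [e|[psi <-]]; last first.
    apply: char_eq => a; rewrite !dual_mapE (short_exact_comp0 sip).
    exact: char0.
  have [s ps] := choice sp.
  have chiE b b' : p b = p b' -> char_fun chi b = char_fun chi b'.
    move=> pe; apply/subr0_eq; rewrite -charB.
    have /ip[a <-] : p (b - b') = 0 by rewrite linearB pe subrr.
    by rewrite -dual_mapE e.
  have [|psi psiE] := @mk_char C (fun c => char_fun chi (s c)).
    by move=> x y; rewrite -charD; apply: chiE; rewrite linearD !ps.
  by exists psi; apply: char_eq => b; rewrite dual_mapE psiE; apply: chiE; rewrite ps.
- move=> chi; have [psi [psiD psiE]] := char_extension ii (charD chi).
  have [f fE] := mk_char psiD.
  by exists f; apply: char_eq => a; rewrite dual_mapE fE.
Qed.

End Dual.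

(** * Double duals *)

Section DoubleDual.
Variables (R : pzRingType) (sigma tau : antihom R).
Hypothesis sigmaK : forall a, sigma (tau a) = a.

(** Both maps encode one pairing of [A] and [M] into Q/Z; [sigmaK] turns linearity in one argument
    into linearity in the other. *)
Lemma dual_swap (A M : lmodType R) (phi : {linear A -> dual M sigma}) :
  exists psi : {linear M -> dual A tau},
    forall m a, char_fun (psi m) a = char_fun (phi a) m.
Proof.
have psiD m : (fun a => char_fun (phi a) m) \in @char_pred R A.
  by rewrite -topredE /= asboolE => x y; rewrite linearD.
have psiL : linear (fun m => Char (psiD m) : dual A tau).
  move=> r x y; apply: char_eq => a.
  rewrite -[RHS]/(char_fun (phi (tau r *: a)) x + char_fun (phi a) y).
  by rewrite linearZ -[LHS]/(char_fun (phi a) (r *: x + y)) charD char_funZ sigmaK.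
by exists (Lin psiL) => m a; rewrite LinE.
Qed.

Lemma dual_eval_ex (M : lmodType R) :
  exists psi : {linear M -> dual (dual M sigma) tau},
    forall m chi, char_fun (psi m) chi = char_fun chi m.
Proof.
have idL : linear (fun chi : dual M sigma => chi) by [].
have [psi psiE] := dual_swap (Lin idL).
by exists psi => m chi; rewrite psiE LinE.
Qed.

Definition dual_eval M := sval (cid (dual_eval_ex M)).

Lemma dual_evalE (M : lmodType R) (m : M) (chi : dual M sigma) :
  char_fun (dual_eval M m) chi = char_fun chi m.
Proof. exact: (svalP (cid (dual_eval_ex M))). Qed.

(* A system of linear equations over M whose solvability in the double dual is
   not reflected in M is detected by a character of M^I. *)
Lemma dual_eval_pure (M : lmodType R) (I J : finType) (a : I -> J -> R)
    (c : I -> M) (xi : J -> dual (dual M sigma) tau) :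
    (forall i, \sum_j a i j *: xi j = dual_eval M (c i)) ->
  exists x : J -> M, forall i, \sum_j a i j *: x j = c i.
Proof.
move=> xiE; apply: contrapT => nox.
pose H : set (I -> M) := fun h => exists x : J -> M, forall i, \sum_j a i j *: x j = h i.
have [|||chi [chiD chiH chic]] := @divisible_separation QZ QZ_div QZ_torsion (I -> M) H c.
- by exists (fun=> 0) => i; rewrite big1 // => j _; rewrite scaler0.
- move=> f g [x xE] [y yE]; exists (fun j => x j - y j) => i.
  rewrite -[RHS]/(f i - g i) -xE -yE -sumrB.
  by apply: eq_bigr => j _; rewrite scalerBr.
- by move=> [x xE]; apply: nox; exists x.
have chi0 : chi 0 = 0 by apply: (addrI (chi 0)); rewrite -chiD !addr0.
have chi_sum (K : finType) (F : K -> I -> M) : chi (\sum_k F k) = \sum_k chi (F k).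
  by elim/big_rec2: _ => [|k x y _ <-]; rewrite ?chi0 ?chiD.
pose d i (m : M) : I -> M := fun i' => if i' == i then m else 0.
have dD i : {morph d i : x y / x + y}.
  by move=> x y; apply/funext => i'; rewrite fctE /d; case: eqP; rewrite ?addr0.
have dE h : h = \sum_i d i (h i).
  apply/funext => i; rewrite fct_sumE (bigD1 i) //= /d eqxx big1 ?addr0 // => i'.
  by rewrite eq_sym => /negPf ->.
(* The coordinates of [chi]. Evaluating the i-th equation at [psi i] and summing over i computes
   [chi c]. *)
have /choice[psi psiE] i : exists psi : dual M sigma, char_fun psi = chi \o d i.
  by apply: mk_char => x y; rewrite /= dD chiD.
apply: chic; rewrite (dE c) chi_sum.
have -> : \sum_i chi (d i (c i)) = \sum_i char_fun (\sum_j a i j *: xi j) (psi i).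
  by apply: eq_bigr => i _; rewrite xiE dual_evalE psiE.
have sumE (K : finType) (N : lmodType R) (rho : antihom R) (F : K -> dual N rho) n :
    char_fun (\sum_k F k) n = \sum_k char_fun (F k) n.
  by elim/big_rec2: _ => // k x y _ <-.
have sumE' (K : finType) (N : lmodType R) (rho : antihom R) (f : dual N rho) (n : K -> N) :
    char_fun f (\sum_k n k) = \sum_k char_fun f (n k).
  by elim/big_rec2: _ => [|k x y _ <-]; rewrite ?char0 ?charD.
under eq_bigr => i _ do rewrite sumE.
rewrite exchange_big /= big1 // => j _.
(* [xi j] is evaluated at the sum over i of [tau (a i j) *: psi i]. This character sends m to the
   value of [chi] at the family of the [a i j *: m], which lies in [H], so it is zero. *)
rewrite -sumE' -[RHS](char0 (xi j)); congr char_fun.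
apply: char_eq => m; rewrite sumE -[RHS]/(0 : QZ).
rewrite -[RHS](chiH (\sum_i d i (a i j *: m))); last first.
  exists (fun j' => if j' == j then m else 0) => i.
  rewrite -[in RHS](dE (fun i => a i j *: m)) (bigD1 j) //= eqxx big1 ?addr0 //.
  by move=> j' /negPf ->; rewrite scaler0.
rewrite chi_sum; apply: eq_bigr => i _.
by rewrite char_funZ psiE sigmaK.
Qed.

Lemma dual_eval_inj M : injective (dual_eval M).
Proof.
move=> x y e; apply/subr0_eq.
(* Purity for a single equation in no unknowns, with constant x - y. *)
have [|z zE] := @dual_eval_pure M unit void (fun _ => of_void R) (fun=> x - y) (of_void _).
  by move=> _; rewrite big_pred0 => [|[]]; rewrite linearB e subrr.
by rewrite -(zE tt) big_pred0 // => -[].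
Qed.

End DoubleDual.

(** * Resolutions and dimension shifting *)

Section ResolutionLength.
Variable R : pzRingType.

(** The predicates minimised by [proj_dim] and [inj_dim]. They are upward closed in [n], so each
    expresses an upper bound on a dimension. *)
Definition pres_len (n : nat) (M : lmodType R) :=
  exists (P : nat -> lmodType R)
    (d : forall i, {linear P i.+1 -> P i}) (e : {linear P 0%N -> M}),
    projective_resolution d e /\ zero_above P n.

Definition ires_len (n : nat) (M : lmodType R) :=
  exists (I : nat -> lmodType R)
    (e : {linear M -> I 0%N}) (d : forall i, {linear I i -> I i.+1}),
    injective_resolution e d /\ zero_above I n.

Lemma zero_above_leq (X : nat -> lmodType R) m n :
  (m <= n)%N -> zero_above X m -> zero_above X n.
Proof. by move=> mn X0 i /(leq_ltn_trans mn); exact: X0. Qed.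

Lemma pres_len_leq m n M : (m <= n)%N -> pres_len m M -> pres_len n M.
Proof.
move=> mn [P [d [e [res X0]]]]; exists P, d, e; split=> //.
exact: zero_above_leq X0.
Qed.

Lemma ires_len_leq m n M : (m <= n)%N -> ires_len m M -> ires_len n M.
Proof.
move=> mn [I [e [d [res X0]]]]; exists I, e, d; split=> //.
exact: zero_above_leq X0.
Qed.

Lemma zero_module_projective : module_projective ('rV[R]_0).
Proof.
move=> A B g f _; exists (Lin (@zero_linear R _ A)) => x.
by rewrite LinE [x]thinmx0 !linear0.
Qed.

Lemma zero_module_injective : module_injective ('rV[R]_0).
Proof.
move=> A B g f _; exists (Lin (@zero_linear R B _)) => x.
by rewrite LinE [f x]thinmx0.
Qed.

Lemma pres_len0P M : pres_len 0 M <-> module_projective M.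
Proof.
split=> [[P [d [e [[prP se ex _] P0]]]]|prM].
  move=> A B g f sg; have [h gh] := prP 0%N A B g (f \o e)%FUN sg.
  have [k kE] : exists k : {linear M -> A}, forall x, k (e x) = h x.
    apply: factor_surj => // x /ex[y <-].
    by rewrite (P0 1%N isT y) !linear0.
  by exists k => m; have [x <-] := se m; rewrite kE gh.
pose P i : lmodType R := if i is 0 then M else 'rV[R]_0.
exists P, (fun i => Lin (@zero_linear R (P i.+1) (P i))), (Lin (@id_linear R M)).
have z i (x : P i.+1) : x = 0 by rewrite [x]thinmx0.
split; last by case=> // i _; exact: z.
split=> [[|i]|m|x|i x].
- exact: prM.
- exact: zero_module_projective.
- by exists m; rewrite LinE.
- by rewrite LinE; split=> [->|[y <-]]; [exists 0|]; rewrite LinE.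
- by split=> [_|_]; [exists 0; rewrite LinE (z _ x) | rewrite (z _ x) linear0].
Qed.

Lemma ires_len0P M : ires_len 0 M <-> module_injective M.
Proof.
split=> [[I [e [d [[inI ie ex _] I0]]]]|inM].
  move=> A B g f ig; have [h gh] := inI 0%N A B g (e \o f)%FUN ig.
  have [k kE] : exists k : {linear B -> M}, forall x, e (k x) = h x.
    by apply: factor_inj => // x; apply/ex; exact: I0.
  by exists k => a; apply: ie; rewrite kE gh.
pose I i : lmodType R := if i is 0 then M else 'rV[R]_0.
exists I, (Lin (@id_linear R M)), (fun i => Lin (@zero_linear R (I i) (I i.+1))).
have z i (x : I i.+1) : x = 0 by rewrite [x]thinmx0.
split; last by case=> // i _; exact: z.
split=> [[|i]|x y|x|i x].
- exact: inM.
- exact: zero_module_injective.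
- by rewrite !LinE.
- by rewrite LinE; split=> // _; exists x; rewrite LinE.
- by split=> [_|_]; [exists 0; rewrite LinE (z _ x) | rewrite (z _ x) linear0].
Qed.

Lemma pres_lenS n M : pres_len n.+1 M <->
  exists (K F : lmodType R) (i : {linear K -> F}) (p : {linear F -> M}),
    [/\ short_exact i p, module_projective F & pres_len n K].
Proof.
split=> [[P [d [e [[prP se ex exd] P0]]]]|].
  have [e' eE] : exists e' : {linear P 1%N -> kerm e},
      forall x, kerm_incl e (e' x) = d 0%N x.
    apply: factor_inj => [|x]; first exact: kerm_incl_inj.
    by apply/kerm_exact/ex; exists x.
  exists (kerm e), (P 0%N), (kerm_incl e), e; split=> //; first exact: kerm_short_exact.
  exists (fun i => P i.+1), (fun i => d i.+1), e'; split=> [|i ni x].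
    split=> // [x|x].
      have /ex[y yx] : e (kerm_incl e x) = 0 by apply/kerm_exact; exists x.
      by exists y; apply: (@kerm_incl_inj _ _ _ e); rewrite eE.
    rewrite -(exd 0%N) -eE; split=> [->|]; first by rewrite linear0.
    by rewrite -[RHS](linear0 (kerm_incl e)) => /kerm_incl_inj.
  exact: P0.
move=> [K [F [i [p [[ii ip sp] prF [P [d [e [[prP se ex exd] P0]]]]]]]]].
pose P' k : lmodType R := if k is k'.+1 then P k' else F.
pose d' k : {linear P' k.+1 -> P' k} :=
  match k with 0 => (i \o e)%FUN | k'.+1 => d k' end.
exists P', d', p; split; last by case.
split=> [[|k]|//|b|[|k]].
- exact: prF.
- exact: prP.
- rewrite ip; split=> [[a <-]|[x <-]]; last by exists (e x).
  by have [x <-] := se a; exists x.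
- move=> b; rewrite -ex /=; split=> [|->]; last by rewrite linear0.
  by rewrite -[RHS](linear0 i) => /ii.
- exact: exd.
Qed.

Lemma ires_lenS n D : ires_len n.+1 D <->
  exists (I C : lmodType R) (j : {linear D -> I}) (q : {linear I -> C}),
    [/\ short_exact j q, module_injective I & ires_len n C].
Proof.
split=> [[I [e [d [[inI ie ex exd] I0]]]]|].
  have [e' eE] : exists e' : {linear cokm e -> I 1%N},
      forall x, e' (cokm_proj e x) = d 0%N x.
    apply: factor_surj; first exact: cokm_proj_surj.
    by move=> x /cokm_exact h; apply/ex.
  exists (I 0%N), (cokm e), e, (cokm_proj e); split=> //; first exact: cokm_short_exact.
  exists (fun i => I i.+1), e', (fun i => d i.+1); split=> [|i ni x].
    split=> // [x y|x].
      move=> exy; apply/subr0_eq; move: exy => /eqP; rewrite -subr_eq0 -linearB.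
      have [z <-] := cokm_proj_surj (x - y).
      by rewrite eE => /eqP /ex h; apply/cokm_exact.
    rewrite (exd 0%N); split=> [[y <-]|[c <-]]; first by exists (cokm_proj e y).
    by have [y <-] := cokm_proj_surj c; exists y.
  exact: I0.
move=> [I0 [C [j [q [[ij jq sq] inI0 [I [e [d [[inI ie ex exd] Iz]]]]]]]]].
pose I' k : lmodType R := if k is k'.+1 then I k' else I0.
pose d' k : {linear I' k -> I' k.+1} :=
  match k with 0 => (e \o q)%FUN | k'.+1 => d k' end.
exists I', j, d'; split; last by case.
split=> [[|k]|//|b|[|k]].
- exact: inI0.
- exact: inI.
- rewrite -jq /=; split=> [|->]; last by rewrite linear0.
  by rewrite -[RHS](linear0 e) => /ie.
- move=> b; rewrite /= ex; split=> [[a <-]|[x <-]]; last by exists (q x).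
  by have [x <-] := sq a; exists x.
- exact: exd.
Qed.

Lemma enat_infP (P : nat -> Prop) n :
    (forall a b, (a <= b)%N -> P a -> P b) ->
  (enat_inf P <= (Some n : enat))%O <-> P n.
Proof.
move=> Pmon; rewrite /enat_inf; case: pselect => [exP|nP]; last first.
  by split=> [//|Pn]; case: nP; exists n; apply/asboolP.
case: ex_minnP => m /asboolP Pm mmin.
rewrite -[(_ <= _)%O]/((m <= n)%N); split=> [mn|Pn]; first exact: Pmon Pm.
by apply: mmin; exact/asboolP.
Qed.

Lemma enat_supP (S : enat -> Prop) n :
  (enat_sup S <= (Some n : enat))%O <-> forall x, S x -> (x <= (Some n : enat))%O.
Proof.
by apply: enat_infP => a b ab h x /h hx; apply: Order.POrderTheory.le_trans hx _.
Qed.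

Lemma spli_leP n : (spli R <= (Some n : enat))%O <->
  forall I : lmodType R, module_injective I -> pres_len n I.
Proof.
rewrite enat_supP; split=> [h I inI|h _ [I inI ->]].
  apply/(enat_infP n (fun a b => @pres_len_leq a b I)); apply: h; by exists I.
by apply/(enat_infP n (fun a b => @pres_len_leq a b I)); exact: h.
Qed.

Lemma silp_leP n : (silp R <= (Some n : enat))%O <->
  forall P : lmodType R, module_projective P -> ires_len n P.
Proof.
rewrite enat_supP; split=> [h I inI|h _ [I inI ->]].
  apply/(enat_infP n (fun a b => @ires_len_leq a b I)); apply: h; by exists I.
by apply/(enat_infP n (fun a b => @ires_len_leq a b I)); exact: h.
Qed.

End ResolutionLength.

(** * Injective embeddings, iterated shifting and duality of dimensions *)

Section Shifting.
Variables (R : pzRingType) (sigma tau : antihom R).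
Hypothesis sigmaK : forall a, sigma (tau a) = a.
Hypothesis tauK : forall a, tau (sigma a) = a.
Implicit Types A B C D F I K M N P : lmodType R.

(** An extension problem along an injective [g] into the dual of [P] transposes to a lifting problem
    for [P] along the dual of [g], which is onto. *)
Lemma dual_projective (rho rho' : antihom R) P :
    (forall a, rho (rho' a) = a) -> (forall a, rho' (rho a) = a) ->
  module_projective P -> module_injective (dual P rho).
Proof.
move=> rhoK rhoK' prP A B g f ig.
have [f1 f1E] := dual_swap rhoK f.
have [_ _ sg] := dual_short_exact rho' (cokm_short_exact ig).
have [f2 f2E] := prP _ _ (dual_map rho' g) f1 sg.
have [f3 f3E] := dual_swap rhoK' f2.
exists f3 => a; apply: char_eq => m.
by rewrite f3E -(f1E m) -f2E dual_mapE.
Qed.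

(** An injective module containing [M], not a minimal one: the double dual of [M] embeds into the
    dual of a free cover of the dual. *)
Definition hull M : lmodType R :=
  dual (freem R (dual M sigma)) tau.

Definition hull_incl M : {linear M -> hull M} :=
  (dual_map tau (free_cover (dual M sigma)) \o dual_eval sigmaK M)%FUN.

Lemma hull_incl_inj M : injective (hull_incl M).
Proof.
have [h _ _] := dual_short_exact tau (syz_short_exact (dual M sigma)).
by move=> x y /h; exact: dual_eval_inj.
Qed.

Lemma hull_injective M : module_injective (hull M).
Proof. exact: dual_projective tauK sigmaK (@freem_projective _ _). Qed.

Definition cosyz M : lmodType R := cokm (hull_incl M).

Lemma cosyz_short_exact M : short_exact (hull_incl M) (cokm_proj (hull_incl M)).
Proof. exact/cokm_short_exact/hull_incl_inj. Qed.

Lemma ext1_cosyz K F M (i : {linear K -> F}) (p : {linear F -> M}) D :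
  short_exact i p -> module_projective F -> ext1 K D <-> ext1 M (cosyz D).
Proof.
move=> sip prF; exact: ext1_shift sip prF (cosyz_short_exact D) (@hull_injective D).
Qed.

Lemma ext1_syz M D I C (j : {linear D -> I}) (q : {linear I -> C}) :
  short_exact j q -> module_injective I -> ext1 (syz M) D <-> ext1 M C.
Proof. exact: ext1_shift (syz_short_exact M) (@freem_projective _ _). Qed.

Lemma ext1_syz_cosyz M D : ext1 (syz M) D <-> ext1 M (cosyz D).
Proof. exact: ext1_cosyz (syz_short_exact M) (@freem_projective _ _). Qed.

(** Both sides are the vanishing of Ext^{n+1}(M, D). *)
Lemma ext1_iter n M D : ext1 (iter n (@syz R) M) D <-> ext1 M (iter n cosyz D).
Proof. by elim: n D => [|n IH] D //; rewrite ext1_syz_cosyz IH -iterSr. Qed.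

(** With Ext^{n+1} written through syzygies of the first argument, projective and injective
    dimension are governed by the same formula, quantified over one argument or the other. *)
Lemma pres_lenP n M : pres_len n M <-> forall D, ext1 (iter n (@syz R) M) D.
Proof.
elim: n M => [|n IH] M; first by rewrite pres_len0P projective_ext1.
rewrite pres_lenS; split=> [[K [F [i [p [sip prF]]]]]|e].
  move=> /IH eK D; apply/ext1_iter/(ext1_cosyz _ sip prF); rewrite -/(iter _ _ _).
  exact/ext1_iter.
exists (syz M), (freem R M), (kerm_incl (free_cover M)), (free_cover M); split.
- exact: syz_short_exact.
- exact: freem_projective.
- by apply/IH => D; rewrite -iterSr.
Qed.

Lemma ires_lenP n D : ires_len n D <-> forall M, ext1 (iter n (@syz R) M) D.
Proof.
elim: n D => [|n IH] D; first by rewrite ires_len0P injective_ext1.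
rewrite ires_lenS; split=> [[I [C [j [q [sjq inI]]]]]|e].
  by move=> /IH eC M; rewrite iterS; apply/(ext1_syz _ sjq inI)/eC.
exists (hull D), (cosyz D), (hull_incl D), (cokm_proj (hull_incl D)); split.
- exact: cosyz_short_exact.
- exact: hull_injective.
- by apply/IH => M; apply/ext1_syz_cosyz; exact: (e M).
Qed.

(* Part of the long exact sequence of Ext(-, D):
   Ext^{n+1}(B, D) = 0 and Ext^{n+2}(C, D) = 0 imply Ext^{n+1}(A, D) = 0. *)
Lemma pres_len_sub n A B C (i : {linear A -> B}) (p : {linear B -> C}) :
  short_exact i p -> pres_len n B -> pres_len n.+1 C -> pres_len n A.
Proof.
move=> sip /pres_lenP eB /pres_lenP eC; apply/pres_lenP => D.
move: (eB D) (eC D) => /ext1_iter eB' /ext1_iter eC'; apply/ext1_iter.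
have sD := cosyz_short_exact (iter n cosyz D); have inH := @hull_injective (iter n cosyz D).
apply/(ext1_liftP A sD inH) => g.
have [g' g'E] := eC' _ _ _ _ sip g.
have [h hE] := (ext1_liftP B sD inH).1 eB' g'.
by exists (h \o i)%FUN => a /=; rewrite hE g'E.
Qed.

Lemma dual_ires_len (rho rho' : antihom R) n M :
    (forall a, rho (rho' a) = a) -> (forall a, rho' (rho a) = a) ->
  pres_len n M -> ires_len n (dual M rho).
Proof.
move=> rhoK rhoK'; elim: n M => [|n IH] M.
  by rewrite pres_len0P ires_len0P; exact: dual_projective.
rewrite pres_lenS ires_lenS => -[K [F [i [p [sip prF /IH iK]]]]].
exists (dual F rho), (dual K rho), (dual_map rho p), (dual_map rho i); split=> //.
  exact: dual_short_exact.
exact: dual_projective rhoK rhoK' prF.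
Qed.

(** [B'] stands in for the n-th syzygy of [B]; it arises from other covers, but Ext^1 out of it is
    still Ext^{n+1} out of [B]. *)
Lemma horseshoe_iter n A B C (i : {linear A -> B}) (p : {linear B -> C}) :
    short_exact i p ->
  exists B' (i' : {linear iter n (@syz R) A -> B'}) (p' : {linear B' -> iter n (@syz R) C}),
    short_exact i' p' /\ forall D, ext1 B' D <-> ext1 B (iter n cosyz D).
Proof.
elim: n A B C i p => [|n IH] A B C i p sip; first by exists B, i, p.
have [B1 [F [j [q [i1 [p1 [prF sjq sip1]]]]]]] := horseshoe sip.
have [B' [i' [p' [sip' eB']]]] := IH _ _ _ _ _ sip1.
rewrite !iterSr; exists B', i', p'; split=> // D.
by rewrite eB' (ext1_cosyz _ sjq prF).
Qed.

(** * Consequences of a finite bound on spli *)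

Section FiniteSpli.
Variable n : nat.
Hypothesis spli_n : forall I, module_injective I -> pres_len n I.

(** The bound does not depend on [m]: in [D -> I -> C] both [I] and, by induction, [C] have
    projective dimension at most [n], hence so has the submodule [D]. *)
Lemma ires_pres_len m D : ires_len m D -> pres_len n D.
Proof.
elim: m D => [|m IH] D; first by rewrite ires_len0P; exact: spli_n.
rewrite ires_lenS => -[I [C [j [q [sjq inI /IH pC]]]]].
apply: pres_len_sub sjq (spli_n inI) _.
exact: pres_len_leq pC.
Qed.

(** The horseshoe is applied to [N -> hull N -> cosyz N]. The injective middle term has projective
    dimension at most [n], so its n-th syzygy is projective. *)
Lemma syzygy_step N : exists (T : lmodType R)
    (i : {linear iter n (@syz R) N -> T}) (p : {linear T -> iter n (@syz R) (cosyz N)}),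
  module_projective T /\ short_exact i p.
Proof.
have [T [i [p [sip eT]]]] := horseshoe_iter n (cosyz_short_exact N).
exists T, i, p; split=> //; apply/projective_ext1 => D; apply/eT/ext1_iter.
exact: (pres_lenP n (hull N)).1 (spli_n (@hull_injective N)) D.
Qed.

(** The hypothesis on the dual is the invariant of the coresolution. It bounds the dimensions of the
    double and triple duals, and the dual of the cokernel is the kernel of the map from the triple
    dual onto the dual. *)
Lemma double_dual_step C : pres_len n (dual C sigma) ->
  ires_len n (dual (dual C sigma) tau) /\
  pres_len n (dual (cokm (dual_eval sigmaK C)) sigma).
Proof.
move=> pC.
have iD : ires_len n (dual (dual C sigma) tau) by exact: dual_ires_len tauK sigmaK pC.
split=> //.
have sC := cokm_short_exact (@dual_eval_inj _ _ _ sigmaK C).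
apply: (pres_len_sub (dual_short_exact sigma sC)).
  exact/ires_pres_len/(dual_ires_len sigmaK tauK)/ires_pres_len/iD.
exact: pres_len_leq pC.
Qed.

End FiniteSpli.

Lemma spli_le_silp n m :
    (forall I, module_injective I -> pres_len n I) ->
    (forall P, module_projective P -> ires_len m P) ->
  forall I, module_injective I -> pres_len m I.
Proof.
move=> spliN silpM I inI.
(* If the syzygy of [N] is projective, its injective dimension is at most k, so Ext^1(N, syz N) = 0.
   The presentation of [N] then splits and [N] is projective. Finiteness of [n] starts this descent
   to [m]. *)
have lower k M : (m <= k)%N -> pres_len k.+1 M -> pres_len k M.
  move=> mk /pres_lenP eM; pose N := iter k (@syz R) M.
  have prS : module_projective (syz N) by exact/projective_ext1.
  have eN : ext1 N (syz N).
    exact: (ires_lenP k (syz N)).1 (ires_len_leq mk (silpM _ prS)) M.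
  apply/pres_lenP => D; rewrite -/N.
  apply: (ext1_from_presentation (syz_short_exact N) (@freem_projective _ _)) => f.
  have [r rE] := eN _ _ _ _ (syz_short_exact N) (Lin (@id_linear R (syz N))).
  by exists (f \o r)%FUN => x; rewrite /= rE LinE.
have [nm|mn] := leqP n m; first exact: pres_len_leq nm (spliN I inI).
have : forall d, pres_len (m + d) I -> pres_len m I.
  elim=> [|d IH]; first by rewrite addn0.
  by rewrite addnS => /lower h; apply/IH/h/leq_addr.
by apply; rewrite -> (subnKC (ltnW mn)); exact: spliN.
Qed.

End Shifting.

(** * Null-homotopies into pure exact complexes *)

Section PureExact.
Variables (R : pzRingType) (X : nat -> lmodType R).
Variable d : forall k, {linear X k -> X k.+1}.
Hypothesis d_exact : forall k, exact_at (d k) (d k.+1).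
(* The image of d k is a pure submodule: finite linear systems with constants
   in it that are solvable in X k.+1 are solvable in it. *)
Hypothesis d_pure : forall k (I J : finType) (a : I -> J -> R) (x : J -> X k.+1),
  (forall i, d k.+1 (\sum_j a i j *: x j) = 0) ->
  exists y : J -> X k, forall i, \sum_j a i j *: d k (y j) = \sum_j a i j *: x j.

Let dd k x : d k.+1 (d k x) = 0.
Proof. by apply/d_exact; exists x. Qed.

(** * Complexes with finitely many generators in each degree *)

Section FiniteFamily.
Variable W : nat -> finType.
Variable A : forall k, W k -> W k.+1 -> R.
Variable psi : forall k, W k -> X k.+1.
Arguments A : clear implicits.
Arguments psi : clear implicits.
Hypothesis AA0 : forall k i l, \sum_j A k i j * A k.+1 j l = 0.
Hypothesis psi_chain :
  forall k i, d k.+1 (psi k i) = \sum_j A k i j *: psi k.+1 j.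

(** Equal composites with [A] from the degree below, so that the homotopy equation there cannot tell
    [r] from [r']; no condition in degree 0. *)
Let compat k : (W k -> X k) -> (W k -> X k) -> Prop :=
  match k return (W k -> X k) -> (W k -> X k) -> Prop with
  | 0 => fun _ _ => True
  | k'.+1 => fun r r' =>
      forall i, \sum_j A k' i j *: r j = \sum_j A k' i j *: r' j
  end.

(** A necessary condition on the homotopy in degree k, obtained by composing its equation with [A]
    from the degree below. *)
Let inv k : (W k -> X k) -> Prop :=
  match k return (W k -> X k) -> Prop with
  | 0 => fun _ => True
  | k'.+1 => fun r =>
      forall i, \sum_j A k' i j *: psi k'.+1 j = \sum_j A k' i j *: d k'.+1 (r j)
  end.

Let AAx k (N : lmodType R) (x : W k.+2 -> N) i :
  \sum_j A k i j *: (\sum_l A k.+1 j l *: x l) = 0.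
Proof.
under eq_bigr => j _ do rewrite scaler_sumr.
rewrite exchange_big /= big1 // => l _.
under eq_bigr => j _ do rewrite scalerA.
by rewrite -scaler_suml AA0 scale0r.
Qed.

(* Purity is used twice: to choose r1, then to correct r0 in degree k without
   changing its composite with A, on which the equation in degree k - 1 depends. *)
Let homotopy_step k (r0 : W k -> X k) : inv r0 ->
  exists (r1 : W k.+1 -> X k.+1) (r : W k -> X k), [/\ inv r1, compat r r0 &
    forall i, psi k i = d k (r i) + \sum_j A k i j *: r1 j].
Proof.
move=> r0P.
have [r1 r1P] : exists r1 : W k.+1 -> X k.+1, inv r1.
  have [|y yE] := @d_pure k.+1 _ _ (A k) (psi k.+1); last first.
    by exists y => i; rewrite /= yE.
  move=> i; rewrite linear_sum; under eq_bigr => j _ do rewrite linearZ /= psi_chain.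
  exact: AAx.
(* The defect of the equation for [r0] and [r1]. It is a cycle, hence a boundary, and [r0] is
   corrected by a preimage of it. *)
pose g i := psi k i - d k (r0 i) - \sum_j A k i j *: r1 j.
have dg i : d k.+1 (g i) = 0.
  rewrite /g !linearB dd subr0 psi_chain r1P linear_sum.
  by apply/eqP; rewrite subr_eq0; apply/eqP/eq_bigr => j _; rewrite linearZ.
have /choice[y0 y0E] i : exists y, d k y = g i by apply/d_exact.
suff [y yE yc] : exists2 y : W k -> X k, (forall i, d k (y i) = g i) &
    compat y (fun=> 0).
  exists r1, (fun i => r0 i + y i); split=> // [|i]; last first.
    by rewrite linearD yE /g addrA addrCA subrr addr0 subrK.
  clear - yc; case: k r0 y yc => // k r0 y yc i.
  under eq_bigr => j _ do rewrite scalerDr.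
  by rewrite big_split /= yc [X in _ + X]big1 ?addr0 // => j _; rewrite scaler0.
have gE i : g i = psi k i - d k (r0 i) - \sum_j A k i j *: r1 j by [].
clearbody g; case: k r0 r0P r1 r1P g gE dg y0 y0E => [|k] r0 r0P r1 r1P g gE dg y0 y0E.
  by exists y0.
have gA i : \sum_j A k i j *: g j = 0.
  under eq_bigr => j _ do rewrite gE !scalerBr.
  by rewrite !sumrB r0P AAx subrr subr0.
have [|y1 y1E] := @d_pure k _ _ (A k) y0.
  move=> i; rewrite linear_sum -[RHS](gA i); apply: eq_bigr => j _.
  by rewrite linearZ /= y0E.
exists (fun j => y0 j - d k (y1 j)) => [i|i]; first by rewrite linearB dd subr0.
under eq_bigr => j _ do rewrite scalerBr.
by rewrite sumrB y1E subrr big1 // => j _; rewrite scaler0.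
Qed.

Lemma finite_null_homotopy : exists r : forall k, W k -> X k,
  forall k i, psi k i = d k (r k i) + \sum_j A k i j *: r k.+1 j.
Proof.
(* The state is a provisional homotopy in degree k. Each step fixes the final one in that degree and
   a provisional one in the next; by [compat] the later correction leaves the equation intact. *)
pose st k := {r0 : W k -> X k | inv r0}.
have next k (s : st k) : {q : st k.+1 * (W k -> X k) | compat q.2 (sval s) /\
    forall i, psi k i = d k (q.2 i) + \sum_j A k i j *: sval q.1 j}.
  apply: cid; have [r1 [r [r1P rc rE]]] := homotopy_step (svalP s).
  by exists (exist _ r1 r1P, r).
pose s := fix s k : st k :=
  match k with 0 => exist (@inv 0) (fun=> 0) I | k'.+1 => (sval (next k' (s k'))).1 end.
exists (fun k => (sval (next k (s k))).2) => k i.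
have [_ ->] := svalP (next k (s k)); congr (_ + _).
by have [-> _] := svalP (next k.+1 (s k.+1)).
Qed.

End FiniteFamily.

(** * Free complexes, exhausted by partial homotopies *)

Section FreeComplex.
Variable S : nat -> choiceType.
Let F k : lmodType R := freem R (S k).
Variable delta : forall k, {linear F k -> F k.+1}.
Hypothesis deltadelta : forall k x, delta k.+1 (delta k x) = 0.
Variable psi : forall k, {linear F k -> X k.+1}.
Hypothesis psi_chain : forall k x, d k.+1 (psi k x) = psi k.+1 (delta k x).

Let gen k (s : S k) : F k := fgen R s.

(** A homotopy on the span of the generators in [ph_dom]; the values of [ph_fun] elsewhere are
    arbitrary. *)
Record partial_homotopy := PartialHomotopy {
  ph_dom : forall k, set (S k);
  ph_fun : forall k, S k -> X k }.
Arguments ph_dom : clear implicits.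
Arguments ph_fun : clear implicits.

Definition ph_good (p : partial_homotopy) := forall k s, ph_dom p k s ->
  (forall s', s' \in fsupp (delta k (gen s)) -> ph_dom p k.+1 s') /\
  psi k (gen s) = d k (ph_fun p k s) + fext (ph_fun p k.+1) (delta k (gen s)).

Definition ph_le (p q : partial_homotopy) := forall k s, ph_dom p k s ->
  ph_dom q k s /\ ph_fun p k s = ph_fun q k s.

Lemma finite_closure m (s : S m) : exists L : forall k, seq (S k),
  s \in L m /\ forall k u, u \in L k -> {subset fsupp (delta k (gen u)) <= L k.+1}.
Proof.
(* The generator [s] transported to its own degree [m], and nothing in other degrees. *)
pose init k : seq (S k) :=
  match m =P k with ReflectT e => [:: ecast n (S n) e s] | _ => [::] end.
pose L := fix L k : seq (S k) := match k with
  | 0 => init 0 | k'.+1 => init k'.+1 ++ flatten [seq fsupp (delta k' (gen u)) | u <- L k'] end.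
have sinit : s \in init m.
  by rewrite /init; case: eqP => // e; rewrite (eq_axiomK e) inE.
exists L; split=> [|k u uL v vu].
  case: m s @init @L sinit => [|m] s init L sinit; first exact: sinit.
  by rewrite /= mem_cat; apply/orP; left; exact: sinit.
by rewrite /= mem_cat; apply/orP; right; apply/flatten_mapP; exists u.
Qed.

(** After subtracting the homotopy of [p], extended by zero, the chain map vanishes on [ph_dom p].
    It descends to the quotient spanned by the new generators in the finite closure of [s], where
    the finite case applies. *)
Lemma ph_extend p m (s : S m) : ph_good p ->
  exists q, [/\ ph_good q, ph_le p q & ph_dom q m s].
Proof.
move=> gp; have [L [sL Lcl]] := finite_closure s.
pose U := ph_dom p.
pose t1 k u := if `[< U k u >] then ph_fun p k u else 0.
have t1E k u : U k u -> t1 k u = ph_fun p k u by move=> /asboolT h; rewrite /t1 h.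
pose phi k : {linear F k -> X k.+1} :=
  (psi k \- (d k \o fext (t1 k)) \- (fext (t1 k.+1) \o delta k))%R.
have phiE k x : phi k x = psi k x - d k (fext (t1 k) x) - fext (t1 k.+1) (delta k x).
  by [].
have phiU k u : U k u -> phi k (gen u) = 0.
  move=> Uu; have [Ucl uE] := gp _ _ Uu.
  have e : fext (t1 k.+1) (delta k (gen u)) = fext (ph_fun p k.+1) (delta k (gen u)).
    by apply: eq_fext => v /Ucl; exact: t1E.
  by rewrite phiE uE fext_gen t1E // e addrAC addrK subrr.
have phi_chain k x : d k.+1 (phi k x) = phi k.+1 (delta k x).
  by rewrite !phiE deltadelta linear0 subr0 2!linearB psi_chain dd subr0.
pose l k := [seq u <- undup (L k) | ~~ `[< U k u >]].
pose W k : finType := seq_sub (l k).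
have lP k u : u \in L k -> ~ U k u -> u \in l k.
  by move=> uL nU; rewrite mem_filter mem_undup uL andbT; apply/asboolPn.
have lL k u : u \in l k -> u \in L k /\ ~ U k u.
  by rewrite mem_filter mem_undup => /andP[/asboolPn].
have fextW k (N : lmodType R) (t : S k -> N) x :
    {subset fsupp x <= L k} -> (forall u, U k u -> t u = 0) ->
  fext t x = \sum_(j : W k) fcoef x (ssval j) *: t (ssval j).
  move=> xL tU; rewrite (@fext_seq _ _ _ _ [seq ssval j | j <- enum (W k)]).
  - by rewrite big_map big_enum.
  - by rewrite map_inj_uniq ?enum_uniq //; exact: val_inj.
  - move=> u ux ul; apply: tU; apply: contrapT => nU; move/negP: ul; apply.
    apply/mapP; exists (SeqSub (lP _ _ (xL _ ux) nU)) => //.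
    by rewrite mem_enum.
pose A k (i : W k) (j : W k.+1) := fcoef (delta k (gen (ssval i))) (ssval j).
have WL k (i : W k) : {subset fsupp (delta k (gen (ssval i))) <= L k.+1}.
  by apply: Lcl; have [] := lL _ _ (ssvalP i).
have gW k (N : lmodType R) (g : {linear F k.+1 -> N}) (i : W k) :
    (forall u, U k.+1 u -> g (gen u) = 0) ->
  g (delta k (gen (ssval i))) = \sum_j A k i j *: g (gen (ssval j)).
  by move=> gU; rewrite (fext_eta g) (fextW _ _ _ _ (@WL _ i) gU).
have [||r rE] := @finite_null_homotopy W A (fun k i => phi k (gen (ssval i))).
- move=> k i l'.
  have cL : linear (fun x : F k.+1 => fcoef (delta k.+1 x) (ssval l') : R^o).
    by move=> a x y; rewrite linearP fcoefP.
  have := @gW k R^o (Lin cL) i; rewrite !LinE deltadelta.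
  under eq_bigr => j _ do rewrite LinE.
  move=> <- // u Uu; rewrite LinE; apply/eqP; rewrite -[_ == _]negbK -mem_fsupp.
  apply/negP => h; have [_] := lL _ _ (ssvalP l'); apply.
  by have [Ucl _] := gp _ _ Uu; exact: Ucl.
- by move=> k i; rewrite phi_chain gW //; exact: phiU.
pose r' k u := oapp (r k) 0 (insub u : option (W k)).
have r'U k u : U k u -> r' k u = 0.
  by move=> Uu; rewrite /r'; case: insubP => //= v /lL[].
have r'W k (j : W k) : r' k (ssval j) = r k j by rewrite /r' valK.
exists (@PartialHomotopy (fun k => [set u | U k u \/ u \in L k]%classic)
  (fun k u => t1 k u + r' k u)); split=> [k u /= uU'|k u Uu|]; last by right.
  case: (pselect (U k u)) => [Uu|nU].
    have [Ucl uE] := gp _ _ Uu; split=> [v vu|]; first by left; exact: Ucl.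
    rewrite t1E // r'U // addr0 uE; congr (_ + _); apply: eq_fext => v /Ucl Uv.
    by rewrite t1E // r'U // addr0.
  have uL : u \in L k by case: uU'.
  split=> [v vu|]; first by right; exact: Lcl vu.
  pose i : W k := SeqSub (lP _ _ uL nU).
  have := rE k i; rewrite -/(gen u) phiE /= => /eqP.
  rewrite subr_eq subr_eq => /eqP ->.
  rewrite fext_gen fext_add linearD -(r'W k i) /=.
  rewrite (fextW _ _ (r' k.+1) _ (@WL k i) (r'U k.+1)).
  under [in RHS]eq_bigr => j _ do rewrite r'W.
  have ac (a b c e : X k.+1) : a + b + c + e = e + a + (c + b).
    by rewrite [RHS]addrACA [e + c]addrC [RHS]addrC addrA.
  exact: ac.
by split=> /=; [left | rewrite t1E // r'U // addr0].
Qed.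

(** By Zorn's lemma for preorders, antisymmetry failing because of the arbitrary values outside the
    domains; by [ph_extend] a maximal element is total. *)
Lemma free_null_homotopy : exists t : forall k, {linear F k -> X k},
  forall k x, psi k x = d k (t k x) + t k.+1 (delta k x).
Proof.
pose P := {p : partial_homotopy | ph_good p}.
pose le (p q : P) : bool := `[< ph_le (sval p) (sval q) >].
have empty_good : ph_good (@PartialHomotopy (fun=> set0) (fun _ _ => 0)) by [].
have [|||p pmax] := @ZL_preorder P (exist _ _ empty_good) le.
- by move=> p; apply/asboolP => k s.
- move=> p q r /asboolP pq /asboolP qr; apply/asboolP => k s /pq[/qr[h e] e'].
  by split=> //; rewrite e'.
- move=> C Ctot.
  pose U k : set (S k) := fun s => exists p : P, C p /\ ph_dom (sval p) k s.
  (* The union of the chain: any member defined at [s] gives the same value. *)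
  pose t k s := match pselect (U k s) with
    | left h => ph_fun (sval (sval (cid h))) k s | right _ => 0 end.
  have tE (p : P) k s : C p -> ph_dom (sval p) k s -> t k s = ph_fun (sval p) k s.
    move=> Cp ps; rewrite /t; case: pselect => [h|[]]; last by exists p.
    case: cid => q [Cq qs] /=; case: (Ctot _ _ Cp Cq) => /asboolP; last by move=> /(_ _ _ qs)[].
    by move=> /(_ _ _ ps)[].
  have gU : ph_good (PartialHomotopy U t).
    move=> k s [p [Cp ps]] /=; have [cl e] := svalP p _ _ ps; split.
      by move=> s' /cl ?; exists p.
    rewrite (tE p) // e; congr (_ + _); apply: eq_fext => s' /cl ?.
    by rewrite (tE p).
  exists (exist _ _ gU) => p Cp; apply/asboolP => k s ps; split; first by exists p.
  by rewrite /= (tE p).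
have total k s : ph_dom (sval p) k s.
  have [q [gq pq qs]] := ph_extend s (svalP p).
  by have /asboolP/(_ _ _ qs)[] := pmax (exist _ q gq) (asboolT pq).
exists (fun k => fext (ph_fun (sval p) k)) => k x.
have hL : linear (fun x => d k (fext (ph_fun (sval p) k) x) +
    fext (ph_fun (sval p) k.+1) (delta k x)).
  by move=> a y z; rewrite !linearP scalerDr addrACA.
rewrite -[RHS](LinE hL); apply: freem_linear_eq => s; rewrite LinE fext_gen.
by have [_] := svalP p _ _ (total k s).
Qed.

End FreeComplex.

(** Each [T k] is a retract of a free module, and the free modules form a complex with differential
    [i k.+1 \o delta k \o free_cover (T k)]; its homotopy is restricted along [i]. *)
Theorem pure_null_homotopy (T : nat -> lmodType R)
    (delta : forall k, {linear T k -> T k.+1}) (psi : forall k, {linear T k -> X k.+1}) :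
    (forall k, module_projective (T k)) ->
    (forall k x, delta k.+1 (delta k x) = 0) ->
    (forall k x, d k.+1 (psi k x) = psi k.+1 (delta k x)) ->
  exists h : forall k, {linear T k -> X k},
    forall k x, psi k x = d k (h k x) + h k.+1 (delta k x).
Proof.
move=> prT dd0 chain.
have sec k : exists i : {linear T k -> freem R (T k)}, forall x, free_cover (T k) (i x) = x.
  have [i iE] := prT k _ _ (free_cover (T k)) (Lin (@id_linear R (T k))) (@free_cover_surj _ _).
  by exists i => x; rewrite iE LinE.
pose i k := sval (cid (sec k)).
have iK k x : free_cover (T k) (i k x) = x := svalP (cid (sec k)) x.
have [||t tE] := @free_null_homotopy (fun k => T k)
   (fun k => i k.+1 \o delta k \o free_cover (T k))%FUN _ (fun k => psi k \o free_cover (T k))%FUN.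
- by move=> k x /=; rewrite iK dd0 linear0.
- by move=> k x /=; rewrite iK chain.
exists (fun k => t k \o i k)%FUN => k x.
by have := tE k (i k x); rewrite /= iK.
Qed.

End PureExact.

(** * The comparison of silp and spli *)

Section Comparison.
Variable R : pzRingType.
Variables (X C : nat -> lmodType R).
Variable e : forall k, {linear X k -> C k}.
Variable v : forall k, {linear C k -> X k.+1}.
Hypothesis e_surj : forall k c, exists x, e k x = c.
Hypothesis v_exact : forall k, short_exact (v k) (e k.+1).
Hypothesis v_pure : forall k (I J : finType) (a : I -> J -> R) (c : I -> C k)
    (xi : J -> X k.+1), (forall i, \sum_j a i j *: xi j = v k (c i)) ->
  exists x : J -> C k, forall i, \sum_j a i j *: x j = c i.

Let d k : {linear X k -> X k.+1} := (v k \o e k)%FUN.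

Let d_eq0 k x : d k x = 0 <-> e k x = 0.
Proof.
have [vi _ _] := v_exact k.
rewrite /d /=; split=> [|->]; last by rewrite linear0.
by rewrite -[RHS](linear0 (v k)) => /vi.
Qed.

Let d_exact k : exact_at (d k) (d k.+1).
Proof.
have [_ vE _] := v_exact k.
move=> x; rewrite d_eq0 (vE x); split=> [[c <-]|[y <-]]; last by exists (e k y).
by have [y <-] := e_surj c; exists y.
Qed.

Let d_pure k (I J : finType) (a : I -> J -> R) (x : J -> X k.+1) :
    (forall i, d k.+1 (\sum_j a i j *: x j) = 0) ->
  exists y : J -> X k, forall i, \sum_j a i j *: d k (y j) = \sum_j a i j *: x j.
Proof.
move=> xE; have [_ vE _] := v_exact k.
have /choice[c cE] i : exists c, v k c = \sum_j a i j *: x j.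
  exact/vE/d_eq0.
have [z zE] := v_pure (fun i => esym (cE i)).
have [y yE] := choice (fun j => e_surj (z j)).
exists y => i; rewrite -cE -zE linear_sum; apply: eq_bigr => j _.
by rewrite linearZ /d /= yE.
Qed.

Variables (G T : nat -> lmodType R).
Variable p : forall k, {linear T k -> G k}.
Variable i : forall k, {linear G k -> T k.+1}.
Variables (K : lmodType R) (j : {linear K -> T 0%N}).
Hypothesis T_projective : forall k, module_projective (T k).
Hypothesis j_exact : short_exact j (p 0%N).
Hypothesis i_exact : forall k, short_exact (i k) (p k.+1).
Hypothesis ext1GX : forall k, ext1 (G k) (X k.+1).

Let p_surj k g : exists x, p k x = g.
Proof. by case: k g => [|k] g; [have [_ _] := j_exact | have [_ _] := i_exact k]. Qed.

Let delta k : {linear T k -> T k.+1} := (i k \o p k)%FUN.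

(* Since Ext^1(G k, X k.+1) = 0, f extends to a chain map from T to X, and a
   null-homotopy of the latter restricts to an extension of f to T 0. *)
Lemma extend_along_syzygies (f : {linear K -> C 0%N}) :
  exists h : {linear T 0%N -> C 0%N}, forall x, h (j x) = f x.
Proof.
pose st k := {psi : {linear T k -> X k.+1} | forall x, p k x = 0 -> e k.+1 (psi x) = 0}.
have ev k c : e k.+1 (v k c) = 0 by exact: short_exact_comp0.
have [psi0 psi0E] := ext1GX j_exact (v 0%N \o f)%FUN.
have psi0P x : p 0%N x = 0 -> e 1%N (psi0 x) = 0.
  by have [_ jp _] := j_exact; move=> /jp[y <-]; rewrite psi0E /= ev.
have next k (s : st k) : {s' : st k.+1 | forall x,
    sval s' (delta k x) = d k.+1 (sval s x)}.
  case: s => psi psiP; apply: cid => /=.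
  have [g gE] : exists g : {linear G k -> C k.+1}, forall x, g (p k x) = e k.+1 (psi x).
    by apply: (factor_surj (g := e k.+1 \o psi)%FUN); [exact: p_surj | exact: psiP].
  have [psi' psi'E] := ext1GX (i_exact k) (v k.+1 \o g)%FUN.
  have psi'P x : p k.+1 x = 0 -> e k.+2 (psi' x) = 0.
    by have [_ ip _] := i_exact k; move=> /ip[y <-]; rewrite psi'E /= ev.
  by exists (exist _ psi' psi'P) => x; rewrite /= psi'E /= gE.
pose s := fix s k : st k :=
  match k with 0 => exist _ psi0 psi0P | k'.+1 => sval (next k' (s k')) end.
have [|k x|h hE] :=
    pure_null_homotopy d_exact d_pure (delta := delta) (psi := fun k => sval (s k)) T_projective.
- by move=> k x; rewrite /delta /= (short_exact_comp0 (i_exact k)) linear0.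
- by rewrite -(svalP (next k (s k)) x).
(* On the image of [j] the term through [delta] vanishes, leaving [v (f x) = v (e (h (j x)))], and
   [v] is injective. *)
exists (e 0%N \o h 0%N)%FUN => x; have [vi _ _] := v_exact 0; apply: vi.
have := hE 0%N (j x); rewrite /= psi0E /= => ->.
by rewrite /delta /= (short_exact_comp0 j_exact) !linear0 addr0.
Qed.

End Comparison.

(** * The bound on the injective dimension of projective modules *)

Section FiniteSpli.
Variables (R : pzRingType) (sigma tau : antihom R).
Hypothesis sigmaK : forall a, sigma (tau a) = a.
Hypothesis tauK : forall a, tau (sigma a) = a.
Variable n : nat.
Hypothesis spli_n : forall I : lmodType R, module_injective I -> pres_len n I.

Lemma pure_coresolution (P : lmodType R) : module_projective P ->
  exists (X C : nat -> lmodType R) (e : forall k, {linear X k -> C k})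
      (v : forall k, {linear C k -> X k.+1}),
    [/\ C 0%N = P, forall k c, exists x, e k x = c, forall k, short_exact (v k) (e k.+1),
      forall k (I J : finType) (a : I -> J -> R) (c : I -> C k) (xi : J -> X k.+1),
        (forall i, \sum_j a i j *: xi j = v k (c i)) ->
        exists x : J -> C k, forall i, \sum_j a i j *: x j = c i &
      forall k, ires_len n (X k.+1)].
Proof.
move=> prP.
pose C k : lmodType R := iter k (fun C : lmodType R => cokm (dual_eval sigmaK C)) P.
(* Degree 0 is [P] itself with the identity as [e 0], so the double duals start in degree 1. *)
pose X k : lmodType R := if k is k'.+1 then dual (dual (C k') sigma) tau else P.
pose e k : {linear X k -> C k} := match k with
  | 0 => Lin (@id_linear R P) | k'.+1 => cokm_proj (dual_eval sigmaK (C k')) end.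
have CP k : pres_len n (dual (C k) sigma).
  elim: k => [|k IH]; first exact/spli_n/(dual_projective sigmaK tauK prP).
  by have [] := double_dual_step sigmaK tauK spli_n IH.
exists X, C, e, (fun k => dual_eval sigmaK (C k)); split=> //.
- move=> [|k] c; last exact: cokm_proj_surj.
  by exists c; rewrite /e LinE.
- by move=> k; exact/cokm_short_exact/dual_eval_inj.
- by move=> k I J a c xi; exact: dual_eval_pure.
- by move=> k; have [] := double_dual_step sigmaK tauK spli_n (CP k).
Qed.

Lemma syzygy_coresolution (N : lmodType R) :
  exists (G M T : nat -> lmodType R) (p : forall k, {linear T k -> G k})
      (i : forall k, {linear G k -> T k.+1}) (j : {linear syz (G 0%N) -> T 0%N}),
    [/\ G = (fun k => iter n (@syz R) (M k)), M 0%N = N,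
      forall k, module_projective (T k), short_exact j (p 0%N) &
      forall k, short_exact (i k) (p k.+1)].
Proof.
pose M k : lmodType R := iter k (cosyz sigmaK) N.
pose G k : lmodType R := iter n (@syz R) (M k).
have step k : {T : lmodType R & {i : {linear G k -> T} & {p : {linear T -> G k.+1} |
    module_projective T /\ short_exact i p}}}.
  have [T /cid[i /cid[p ipP]]] := cid (syzygy_step sigmaK tauK spli_n (M k)).
  by exists T, i, p.
pose T k : lmodType R := if k is k'.+1 then projT1 (step k') else freem R (G 0%N).
pose p k : {linear T k -> G k} :=
  match k with 0 => free_cover (G 0%N) | k'.+1 => sval (projT2 (projT2 (step k'))) end.
exists G, M, T, p, (fun k => projT1 (projT2 (step k))), (kerm_incl (free_cover (G 0%N))).
split=> // [[|k]||k].
- exact: freem_projective.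
- by have [] := svalP (projT2 (projT2 (step k))).
- exact: syz_short_exact.
- by have [] := svalP (projT2 (projT2 (step k))).
Qed.

Lemma projective_ires_len (P : lmodType R) : module_projective P -> ires_len n P.
Proof.
move=> prP; apply/(ires_lenP sigmaK tauK) => N.
have [X [C [e [v [CP e_surj v_exact v_pure iX]]]]] := pure_coresolution prP.
have [G [M [T [p [i [j [GE MN prT j_exact i_exact]]]]]]] := syzygy_coresolution N.
have GN : iter n (@syz R) N = G 0%N by rewrite GE MN.
rewrite GN -CP; apply: (ext1_from_presentation j_exact (prT 0%N)) => f.
(* The remaining condition is Ext^{n+1}(M k, X k.+1) = 0, which follows from the injective dimension
   of the double duals. *)
apply: (extend_along_syzygies e_surj v_exact v_pure prT j_exact i_exact) => k.
by move: (iX k) => /(ires_lenP sigmaK tauK) h; rewrite GE; exact: h.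
Qed.

End FiniteSpli.

Theorem corollary5p4 (R : pzRingType)
    (R_iso_opp : exists f : {rmorphism R -> R^c}, bijective f) :
  (silp R <= spli R)%O /\ ((spli R < \top)%O -> silp R = spli R).
Proof.
have [f [g fK gK]] := R_iso_opp.
have gD : {morph g : a b / a + b}.
  by move=> a b; rewrite -{1}[a]gK -{1}[b]gK -rmorphD fK.
(* Retyped so that products of arguments are taken in [R], not in [R^c]. *)
pose g' : R -> R := g.
have gM (a b : R) : g' (a * b) = g' b * g' a.
  have e := rmorphM f (g b) (g a); rewrite !gK in e.
  by rewrite -[RHS]fK; congr (g _); exact: (esym e).
have g1 : g 1 = 1 by rewrite -[RHS]fK (rmorph1 f).
pose sigma : antihom R := @Antihom R f (rmorph1 f) (rmorphD f) (rmorphM f).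
pose tau : antihom R := @Antihom R g' g1 gD gM.
have sigmaK a : sigma (tau a) = a := gK a.
have tauK a : tau (sigma a) = a := fK a.
(* For infinite spli the inequality is trivial and the premise of the equality is false. *)
case E: (spli R) => [n|]; last first.
  by split; [case: (silp R) | rewrite ltxx].
have /spli_leP spli_n : (spli R <= (Some n : enat))%O by rewrite E.
have silp_n : (silp R <= (Some n : enat))%O.
  by apply/silp_leP => P; exact: projective_ires_len sigmaK tauK n spli_n P.
split=> // _; apply/eqP; rewrite eq_le silp_n /= -E.
case F: (silp R) silp_n => [m|] // _.
apply/spli_leP/(spli_le_silp sigmaK tauK spli_n)/silp_leP.
by rewrite F.
Qed.
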